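(* Let $(\mathfrak{h},B_{\mathfrak{h}})$ be a real Lie algebra of compact type endowed with an $\mathrm{ad}_{\mathfrak{h}}$-invariant Euclidean product, and let $\mathfrak{m}$ be a faithful irreducible real representation of $\mathfrak{h}$ of quaternionic type. Consider the representation of $\mathfrak{h}\oplus\mathfrak{sp}(1)$ on $\mathfrak{m}$ induced by the quaternionic structure. If $\dim_{\mathbb{R}}(\Lambda^4\mathfrak{m})^{\mathfrak{h}\oplus\mathfrak{sp}(1)}=1$, then there exists a unique positive real number $r$ such that the induced representation of $(\mathfrak{h}\oplus\mathfrak{sp}(1),B_{\mathfrak{h}}+rB_{\mathfrak{sp}(1)})$ on $\mathfrak{m}$ is an $s$-representation, where $B_{\mathfrak{sp}(1)}$ denotes the scalar product on $\mathfrak{sp}(1)$ for which $\mathfrak{i},\mathfrak{j},\mathfrak{k}$ is an orthonormal basis.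
   Context: A real Lie algebra of compact type means a finite-dimensional real Lie algebra admitting an $\mathrm{ad}$-invariant Euclidean product; it need not be semi-simple. An irreducible real representation $\rho:\mathfrak{h}\to\mathrm{End}(\mathfrak{m})$ is of quaternionic type if the centralizer of $\rho(\mathfrak{h})$ in $\mathrm{End}_{\mathbb{R}}(\mathfrak{m})$ is isomorphic to the quaternion algebra $\mathbb{H}$. Here $\mathfrak{sp}(1)$ is the Lie algebra of imaginary quaternions (with the commutator bracket) with basis $\mathfrak{i},\mathfrak{j},\mathfrak{k}$ the standard imaginary units; it acts on $\mathfrak{m}$ by the corresponding endomorphisms $I,J,K$ commuting with $\mathfrak{h}$ and satisfying the quaternion relations. $\Lambda^4\mathfrak{m}$ is the fourth exterior power over $\mathbb{R}$, and $(\cdot)^{\mathfrak{h}\oplus\mathfrak{sp}(1)}$ denotes the subspace of invariant elements. Definition ($s$-representation). Let $(\mathfrak{l},B_{\mathfrak{l}})$ be a real Lie algebra of compact type with $\mathrm{ad}$-invariant Euclidean product and $\mathfrak{m}$ an irreducible real representation of $\mathfrak{l}$ with $\mathfrak{l}$-invariant Euclidean product $B_{\mathfrak{m}}$ (unique up to a positive constant). On $\mathfrak{g}:=\mathfrak{l}\oplus\mathfrak{m}$ there is a unique skew-symmetric $\mathbb{R}$-bilinear bracket such that (1) it restricts to the Lie bracket on $\mathfrak{l}$; (2) $[a,v]=-[v,a]=av$ for $a\in\mathfrak{l}$, $v\in\mathfrak{m}$; (3) $[\mathfrak{m},\mathfrak{m}]\subset\mathfrak{l}$; (4) $B_{\mathfrak{l}}(a,[v,w])=B_{\mathfrak{m}}(av,w)$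 for $a\in\mathfrak{l}$, $v,w\in\mathfrak{m}$. The representation $\mathfrak{m}$ is an $s$-representation of $(\mathfrak{l},B_{\mathfrak{l}})$ if this bracket satisfies the Jacobi identity (a condition independent of the scaling of $B_{\mathfrak{m}}$). *)

(* Defs.v *)
From HB Require Import structures.
From mathcomp Require Import all_boot all_order all_fingroup all_algebra.
From mathcomp Require Import reals.
From mathcomp Require Import ring.

Set Implicit Arguments.
Unset Strict Implicit.
Unset Printing Implicit Defensive.

Import Order.TTheory GRing.Theory Num.Theory.
Local Open Scope ring_scope.

Definition bilinear_op (R : realType) (U V W : lmodType R) (f : U -> V -> W) :=
  (forall v, linear (f^~ v)) /\ (forall u, linear (f u)).

Definition jacobi_identity (U : zmodType) (br : U -> U -> U) :=
  forall x y z, br x (br y z) + br y (br z x) + br z (br x y) = 0.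

HB.mixin Record Vector_isLieAlgebra (R : realType) L of Vector R L := {
  lie : L -> L -> L;
  lie_bilinear : bilinear_op lie;
  liexx : forall x, lie x x = 0;
  lie_jacobi : jacobi_identity lie
}.

#[short(type="lieAlgType")]
HB.structure Definition LieAlgebra (R : realType) :=
  { L of Vector R L & Vector_isLieAlgebra R L }.

Section DirectSum.
Variables (R : realType) (g1 g2 : lieAlgType R).

Definition lie_pair (x y : (g1 * g2)%type) : (g1 * g2)%type :=
  (lie x.1 y.1, lie x.2 y.2).

Fact lie_pair_bilinear : bilinear_op lie_pair.
Proof.
have [l1 r1] := @lie_bilinear R g1; have [l2 r2] := @lie_bilinear R g2.
split=> [v a x y|u a x y]; rewrite /lie_pair /=.
  by congr pair; [apply: l1 | apply: l2].
by congr pair; [apply: r1 | apply: r2].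
Qed.

Fact lie_pairxx x : lie_pair x x = 0.
Proof. by rewrite /lie_pair !liexx. Qed.

Fact lie_pair_jacobi : jacobi_identity lie_pair.
Proof. by move=> x y z; congr pair; apply: lie_jacobi. Qed.

HB.instance Definition _ := Vector_isLieAlgebra.Build R (g1 * g2)%type
  lie_pair_bilinear lie_pairxx lie_pair_jacobi.
End DirectSum.

(* The coordinates of a quaternion are taken in the basis 1, i, j, k. *)
Definition quat (R : realType) := 'rV[R]_4.
HB.instance Definition _ (R : realType) := Vector.copy (quat R) 'rV[R]_4.

Section Quaternions.
Variable R : realType.
Implicit Types p q : quat R.

Definition mkquat (a b c d : R) : quat R := \row_(i < 4) [:: a; b; c; d]`_i.

Definition qone : quat R := mkquat 1 0 0 0.

Definition qmul p q : quat R :=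
  mkquat
    (p 0 0 * q 0 0 - p 0 1 * q 0 1 - p 0 2 * q 0 2 - p 0 3 * q 0 3)
    (p 0 0 * q 0 1 + p 0 1 * q 0 0 + p 0 2 * q 0 3 - p 0 3 * q 0 2)
    (p 0 0 * q 0 2 - p 0 1 * q 0 3 + p 0 2 * q 0 0 + p 0 3 * q 0 1)
    (p 0 0 * q 0 3 + p 0 1 * q 0 2 - p 0 2 * q 0 1 + p 0 3 * q 0 0).

Fact quatP p q : p 0 0 = q 0 0 -> p 0 1 = q 0 1 -> p 0 2 = q 0 2 ->
  p 0 3 = q 0 3 -> p = q.
Proof.
move=> e0 e1 e2 e3; apply/rowP; case=> [[|[|[|[|//]]]] lt4].
- by have -> : Ordinal lt4 = 0 by exact: val_inj.
- by have -> : Ordinal lt4 = 1 by exact: val_inj.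
- by have -> : Ordinal lt4 = 2 by exact: val_inj.
- by have -> : Ordinal lt4 = 3 by exact: val_inj.
Qed.

Fact qmulA : associative qmul.
Proof. by move=> p q s; apply: quatP; rewrite !mxE /= ?mxE /=; ring. Qed.
Fact qmul1 : left_id qone qmul.
Proof. by move=> p; apply: quatP; rewrite !mxE /= ?mxE /=; ring. Qed.
Fact qmulr1 : right_id qone qmul.
Proof. by move=> p; apply: quatP; rewrite !mxE /= ?mxE /=; ring. Qed.
Fact qmulDl : left_distributive qmul +%R.
Proof. by move=> p q s; apply: quatP; rewrite !mxE /= ?mxE /=; ring. Qed.
Fact qmulDr : right_distributive qmul +%R.
Proof. by move=> p q s; apply: quatP; rewrite !mxE /= ?mxE /=; ring. Qed.
Fact qone_neq0 : qone != 0.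
Proof. by apply/eqP=> /rowP/(_ 0); rewrite !mxE /=; apply/eqP/oner_neq0. Qed.

HB.instance Definition _ := GRing.Zmodule_isNzRing.Build (quat R)
  qmulA qmul1 qmulr1 qmulDl qmulDr qone_neq0.

Fact qscaleAl (a : R) p q : a *: (p * q) = a *: p * q.
Proof. by apply: quatP; rewrite !mxE /= ?mxE /=; ring. Qed.
Fact qscaleAr (a : R) p q : a *: (p * q) = p * (a *: q).
Proof. by apply: quatP; rewrite !mxE /= ?mxE /=; ring. Qed.

HB.instance Definition _ := GRing.Lmodule_isLalgebra.Build R (quat R) qscaleAl.
HB.instance Definition _ := GRing.Lalgebra_isAlgebra.Build R (quat R) qscaleAr.

End Quaternions.

(* The coordinates of an imaginary quaternion are taken in the basis i, j, k. *)
Definition sp1 (R : realType) := 'rV[R]_3.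
HB.instance Definition _ (R : realType) := Vector.copy (sp1 R) 'rV[R]_3.

Section Sp1.
Variable R : realType.
Implicit Types u v : sp1 R.

Definition quat_of_sp1 u : quat R := mkquat 0 (u 0 0) (u 0 1) (u 0 2).
Definition sp1_of_quat (q : quat R) : sp1 R :=
  \row_(i < 3) [:: q 0 1; q 0 2; q 0 3]`_i.

Definition sp1_lie u v : sp1 R :=
  sp1_of_quat (quat_of_sp1 u * quat_of_sp1 v - quat_of_sp1 v * quat_of_sp1 u).

Fact sp1P u v : u 0 0 = v 0 0 -> u 0 1 = v 0 1 -> u 0 2 = v 0 2 -> u = v.
Proof.
move=> e0 e1 e2; apply/rowP; case=> [[|[|[|//]]] lt3].
- by have -> : Ordinal lt3 = 0 by exact: val_inj.
- by have -> : Ordinal lt3 = 1 by exact: val_inj.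
- by have -> : Ordinal lt3 = 2 by exact: val_inj.
Qed.

Lemma sp1_lieE u v : sp1_lie u v = \row_(i < 3)
  [:: 2 * (u 0 1 * v 0 2 - u 0 2 * v 0 1);
      2 * (u 0 2 * v 0 0 - u 0 0 * v 0 2);
      2 * (u 0 0 * v 0 1 - u 0 1 * v 0 0)]`_i.
Proof.
rewrite /sp1_lie -![_ * _]/(qmul _ _) /sp1_of_quat /qmul /quat_of_sp1.
by apply: sp1P; rewrite 4!mxE /= !mxE /= ?mxE /=; ring.
Qed.

Lemma quat_of_sp1_lie u v : quat_of_sp1 (sp1_lie u v) =
  quat_of_sp1 u * quat_of_sp1 v - quat_of_sp1 v * quat_of_sp1 u.
Proof.
rewrite -![_ * _]/(qmul _ _) sp1_lieE /qmul /quat_of_sp1.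
by apply: quatP; rewrite !mxE /= ?mxE /= ?mxE /=; ring.
Qed.

Fact sp1_lie_bilinear : bilinear_op sp1_lie.
Proof.
by split=> [v a x y|u a x y]; apply: sp1P; rewrite !sp1_lieE !mxE /=; ring.
Qed.
Fact sp1_liexx u : sp1_lie u u = 0.
Proof. by apply: sp1P; rewrite !sp1_lieE !mxE /=; ring. Qed.
Fact sp1_lie_jacobi : jacobi_identity sp1_lie.
Proof.
by move=> x y z; apply: sp1P; rewrite !sp1_lieE !mxE /= ?mxE /=; ring.
Qed.

HB.instance Definition _ := Vector_isLieAlgebra.Build R (sp1 R)
  sp1_lie_bilinear sp1_liexx sp1_lie_jacobi.

Definition sp1_form u v : R := \sum_(i < 3) u 0 i * v 0 i.

End Sp1.

Section Forms.
Variable R : realType.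

Definition euclidean_product (U : lmodType R) (B : U -> U -> R^o) :=
  [/\ bilinear_op B, forall x y, B x y = B y x & forall x, x != 0 -> 0 < B x x].

Definition ad_invariant (g : lieAlgType R) (B : g -> g -> R^o) :=
  forall x y z, B (lie x y) z = B x (lie y z).

End Forms.

Section Representations.
Variables (R : realType) (g : lieAlgType R) (V : vectType R).
Implicit Types (rho : g -> 'End(V)) (T : 'End(V)).

Definition representation rho :=
  linear rho /\
  forall x y, rho (lie x y) = (rho x \o rho y)%VF - (rho y \o rho x)%VF.

Definition irreducible_rep rho :=
  [/\ representation rho, {:V}%VS != 0%VS &
      forall U : {vspace V}, (forall x, (rho x @: U <= U)%VS) ->
        U = 0%VS \/ U = {:V}%VS].

Definition faithful_rep rho := injective rho.

Definition rep_invariant rho (B : V -> V -> R^o) :=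
  forall x v w, B (rho x v) w + B v (rho x w) = 0.

Definition commutes_with rho T :=
  forall x, (T \o rho x)%VF = (rho x \o T)%VF.

Definition quaternionic_type rho :=
  irreducible_rep rho /\
  exists phi : {linear quat R -> 'End(V)},
    [/\ phi 1 = \1%VF,
        forall p q, phi (p * q) = (phi p \o phi q)%VF,
        injective phi &
        forall T, commutes_with rho T <-> exists q, T = phi q].

Definition quaternionic_structure rho (I J K : 'End(V)) :=
  [/\ commutes_with rho I, commutes_with rho J & commutes_with rho K] /\
  [/\ (I \o I)%VF = - \1%VF, (J \o J)%VF = - \1%VF, (K \o K)%VF = - \1%VF
    & (I \o J \o K)%VF = - \1%VF].

Definition rep_plus_sp1 rho (I J K : 'End(V)) (a : (g * sp1 R)%type) :
    'End(V) :=
  rho a.1 + a.2 0 0 *: I + a.2 0 1 *: J + a.2 0 2 *: K.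

Definition rep_invariants rho : {vspace V} :=
  (\bigcap_(i < \dim {:g}) lker (rho (vbasis {:g})`_i))%VS.

Lemma rep_invariantsP rho v : linear rho ->
  reflect (forall x, rho x v = 0) (v \in rep_invariants rho).
Proof.
move=> lin_rho.
pose aM := GRing.isLinear.Build R g 'End(V) _ rho lin_rho.
pose f : {linear g -> 'End(V)} := HB.pack rho aM.
apply: (iffP idP) => [vinv x|vinv]; last first.
  by apply/subv_bigcapP => i _; rewrite -memvE memv_ker vinv.
rewrite (coord_vbasis (memvf x)) -[rho]/(f : g -> _) linear_sum sum_lfunE.
apply: big1 => i _; rewrite linearZ lfunE /=.
have /subv_bigcapP/(_ i isT) : (<[v]> <= rep_invariants rho)%VS by [].
by rewrite -memvE memv_ker => /eqP ->; rewrite scaler0.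
Qed.

End Representations.

Definition sum_form (R : realType) (g1 g2 : lieAlgType R)
    (B1 : g1 -> g1 -> R^o) (r : R) (B2 : g2 -> g2 -> R^o)
    (x y : (g1 * g2)%type) : R^o :=
  B1 x.1 y.1 + r * B2 x.2 y.2.

Section SRepresentations.
Variables (R : realType) (l : lieAlgType R) (m : vectType R).
Implicit Types (B : l -> l -> R^o) (Bm : m -> m -> R^o) (rho : l -> 'End(m)).

Definition s_bracket B rho Bm (br : l * m -> l * m -> (l * m)%type) :=
  [/\ bilinear_op br, forall x y, br x y = - br y x &
  [/\ forall a b : l, br (a, 0) (b, 0) = (lie a b, 0),
      forall (a : l) (v : m), br (a, 0) (0, v) = (0, rho a v),
      forall v w : m, (br (0, v) (0, w)).2 = 0 &
      forall (a : l) (v w : m),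
        B a (br (0, v) (0, w)).1 = Bm (rho a v) w]].

(* The bracket is unique by s_bracket_uniq, and rescaling Bm rescales its     *)
(* m x m component, so that the choice of Bm does not matter.                 *)
Definition s_representation B rho :=
  [/\ euclidean_product B, ad_invariant B, irreducible_rep rho &
  exists Bm, [/\ euclidean_product Bm, rep_invariant rho Bm &
  exists br, s_bracket B rho Bm br /\ jacobi_identity br]].

Lemma s_bracket_uniq B rho Bm br1 br2 : euclidean_product B ->
  s_bracket B rho Bm br1 -> s_bracket B rho Bm br2 -> br1 =2 br2.
Proof.
move=> [[Bl Br] _ Bpos] [[l1 r1] s1 [a1 b1 c1 d1]] [[l2 r2] s2 [a2 b2 c2 d2]].
have dec (x : (l * m)%type) : x = 1 *: (x.1, 0) + (0, x.2).
  by case: x => a v; rewrite scale1r; congr pair; rewrite /= ?addr0 ?add0r.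
have e v w : br1 (0, v) (0, w) = br2 (0, v) (0, w).
  rewrite [LHS]surjective_pairing [RHS]surjective_pairing c1 c2; congr pair.
  set p := _.1; set q := _.1; apply/eqP; rewrite -subr_eq0; apply/negPn/negP.
  move/Bpos; have := Br (p - q) (-1) q p.
  by rewrite [-1 *: q + p]addrC !scaleN1r d1 d2 addNr => ->; rewrite ltxx.
move=> x y; rewrite (dec x) (dec y) !l1 !l2 !r1 !r2 !scale1r.
by rewrite a1 a2 b1 b2 [br1 (0, _) (_, 0)]s1 [br2 (0, _) (_, 0)]s2 b1 b2 e.
Qed.

End SRepresentations.

(* The exterior power of V is realized as the space of antisymmetric tensors, *)
(* a tensor being given by its coordinates in the basis vbasis {:V}.        *)
(* It is characterized by ext_pow_span and ext_pow_universal.                 *)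
Section ExteriorPower.
Variables (R : realType) (k : nat) (V : vectType R).

Local Notation e := (vbasis {:V}).

Definition tensor_pow := {ffun {ffun 'I_k -> 'I_(\dim {:V})} -> R^o}.
HB.instance Definition _ := Vector.on tensor_pow.

Implicit Types (v : {ffun 'I_k -> V}) (t : tensor_pow) (s : 'S_k).
Implicit Types (f : {ffun 'I_k -> 'I_(\dim {:V})}) (A : 'End(V)).

Definition upd (T : Type) (v : {ffun 'I_k -> T}) (p : 'I_k) (x : T) :
  {ffun 'I_k -> T} := [ffun i => if i == p then x else v i].

Definition perm_args (T : Type) (v : {ffun 'I_k -> T}) (s : 'S_k) :
  {ffun 'I_k -> T} := [ffun i => v (s i)].

Definition decomposable v : tensor_pow :=
  [ffun f : {ffun 'I_k -> 'I_(\dim {:V})} => \prod_i coord e (f i) (v i)].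

Definition wedge v : tensor_pow :=
  \sum_(s : 'S_k) (-1) ^+ s *: decomposable (perm_args v s).

Definition antisym_defect s t : tensor_pow :=
  [ffun f => t (perm_args f s) - (-1) ^+ s * t f].

Fact antisym_defect_linear s : linear (antisym_defect s).
Proof.
move=> a t u; apply/ffunP=> f; rewrite !ffunE scalerBr mulrDr opprD addrACA.
by rewrite -!scalerAr.
Qed.
HB.instance Definition _ s := GRing.isLinear.Build R tensor_pow tensor_pow _
  (antisym_defect s) (antisym_defect_linear s).

Definition ext_pow : {vspace tensor_pow} :=
  (\bigcap_(s : 'S_k) lker (linfun (antisym_defect s)))%VS.

Lemma ext_powP t :
  reflect (forall s f, t (perm_args f s) = (-1) ^+ s * t f) (t \in ext_pow).
Proof.
apply: (iffP idP) => [tE s f|tE].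
  have /subv_bigcapP/(_ s isT) : (<[t]> <= ext_pow)%VS by [].
  rewrite -memvE memv_ker lfunE => /eqP/ffunP/(_ f); rewrite !ffunE.
  by move/subr0_eq.
apply/subv_bigcapP => s _; rewrite -memvE memv_ker lfunE; apply/eqP/ffunP => f.
by rewrite !ffunE tE subrr.
Qed.

Definition tensor_act_fun A t : tensor_pow :=
  [ffun f : {ffun 'I_k -> 'I_(\dim {:V})} => \sum_(p < k) \sum_(j < \dim {:V})
     t (upd f p j) * coord e (f p) (A e`_j)].

Fact tensor_act_linear A : linear (tensor_act_fun A).
Proof.
move=> a t u; apply/ffunP=> f; rewrite !ffunE /= scaler_sumr -big_split /=.
apply: eq_bigr => p _; rewrite scaler_sumr -big_split /=.
by apply: eq_bigr => j _; rewrite !ffunE mulrDl scalerAl.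
Qed.
HB.instance Definition _ A := GRing.isLinear.Build R tensor_pow tensor_pow _
  (tensor_act_fun A) (tensor_act_linear A).

Definition tensor_act A : 'End(tensor_pow) := linfun (tensor_act_fun A).

Fact coord_act A (x : V) i :
  coord e i (A x) = \sum_j coord e j x * coord e i (A e`_j).
Proof.
rewrite {1}(coord_vbasis (memvf x)) !linear_sum.
by apply: eq_bigr => j _; rewrite !linearZ.
Qed.

Lemma tensor_act_decomposable A v :
  tensor_act A (decomposable v) = \sum_p decomposable (upd v p (A (v p))).
Proof.
apply/ffunP=> f; rewrite lfunE sum_ffunE !ffunE; apply: eq_bigr => p _.
rewrite ffunE (bigD1 p) //= ffunE eqxx coord_act mulr_suml.
apply: eq_bigr => j _; rewrite ffunE (bigD1 p) //= ffunE eqxx mulrAC.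
congr (_ * _); apply: eq_bigr => i /negPf ip.
by rewrite !ffunE ip.
Qed.

Lemma tensor_act_wedge A v :
  tensor_act A (wedge v) = \sum_p wedge (upd v p (A (v p))).
Proof.
rewrite linear_sum /= exchange_big; apply: eq_bigr => s _.
rewrite linearZ /= tensor_act_decomposable -scaler_sumr; congr (_ *: _).
rewrite [RHS](reindex_inj (@perm_inj _ s)); apply: eq_bigr => p _.
congr decomposable; apply/ffunP => i; rewrite !ffunE.
by rewrite (inj_eq perm_inj).
Qed.

Definition multilinear_map (W : lmodType R) (F : {ffun 'I_k -> V} -> W) :=
  forall v p, linear (fun x => F (upd v p x)).

Definition alternating_map (W : lmodType R) (F : {ffun 'I_k -> V} -> W) :=
  forall v i j, i != j -> v i = v j -> F v = 0.

Lemma decomposable_multilinear : multilinear_map decomposable.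
Proof.
move=> v p a x y; apply/ffunP => f.
have E z : decomposable (upd v p z) f =
    coord e (f p) z * \prod_(i | i != p) coord e (f i) (v i).
  rewrite ffunE (bigD1 p) //= ffunE eqxx; congr (_ * _).
  by apply: eq_bigr => i /negPf ip; rewrite ffunE ip.
by rewrite E linearP mulrDl -mulrA -!E [RHS]ffunE [X in _ = X + _]ffunE.
Qed.

Lemma wedge_multilinear : multilinear_map wedge.
Proof.
move=> v p a x y; rewrite /wedge scaler_sumr -big_split; apply: eq_bigr => s _.
have E z : perm_args (upd v p z) s = upd (perm_args v s) ((s^-1)%g p) z.
  apply/ffunP => i; rewrite !ffunE; congr (if _ then _ else _).
  by rewrite -[RHS](inj_eq (@perm_inj _ s)) permKV.
rewrite /= scalerA mulrC -scalerA -scalerDr; congr (_ *: _).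
by rewrite !E decomposable_multilinear.
Qed.

Lemma wedge_perm v s : wedge (perm_args v s) = (-1) ^+ s *: wedge v.
Proof.
rewrite /wedge scaler_sumr (reindex_inj (mulIg s^-1%g)) /=.
apply: eq_bigr => u _; rewrite scalerA odd_permM odd_permV signr_addb.
rewrite mulrC; congr (_ *: decomposable _); apply/ffunP => i.
by rewrite !ffunE permM permKV.
Qed.

Lemma wedge_alternating : alternating_map wedge.
Proof.
move=> v i j ij vij.
have vt : perm_args v (tperm i j) = v.
  by apply/ffunP=> p; rewrite ffunE; case: tpermP => [->|->|].
have /eqP := wedge_perm v (tperm i j).
rewrite vt odd_tperm ij expr1 scaleN1r -addr_eq0 -mulr2n -scaler_nat.
by rewrite scaler_eq0 pnatr_eq0 => /eqP.
Qed.

Lemma wedge_in_ext_pow v : wedge v \in ext_pow.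
Proof.
apply/ext_powP => s f; rewrite !sum_ffunE mulr_sumr.
rewrite (reindex_inj (mulgI s)) /=; apply: eq_bigr => u _.
rewrite !ffunE odd_permM signr_addb -[_ *: _]mulrA; congr (_ * (_ * _)).
rewrite [RHS](reindex_inj (@perm_inj _ s)); apply: eq_bigr => i _.
by rewrite !ffunE permM.
Qed.

Definition basis_args f : {ffun 'I_k -> V} :=
  [ffun i => e`_(f i)].

Fact decomposable_basis f g : decomposable (basis_args f) g = (f == g)%:R.
Proof.
rewrite ffunE; have [<-|/eqP/ffunP fg] := eqVneq f g.
  by apply: big1 => i _; rewrite ffunE coord_free ?(basis_free (vbasisP _)) ?eqxx.
have /existsP[i fgi] : [exists i, f i != g i].
  by rewrite -negb_forall; apply/negP => /forallP e; apply: fg => i; apply/eqP.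
by rewrite (bigD1 i) //= ffunE coord_free ?(basis_free (vbasisP _)) // (negPf fgi) mul0r.
Qed.

Lemma ext_pow_span t : t \in ext_pow ->
  t = \sum_f ((k`!)%:R^-1 * t f) *: wedge (basis_args f).
Proof.
move=> /ext_powP tE.
have tsum : t = \sum_f t f *: decomposable (basis_args f).
  apply/ffunP => g; rewrite sum_ffunE (bigD1 g) //= big1 ?addr0 => [|f /negPf fg].
    by rewrite ffunE decomposable_basis eqxx [_ *: _]mulr1.
  by rewrite ffunE decomposable_basis fg scaler0.
have -> : \sum_f ((k`!)%:R^-1 * t f) *: wedge (basis_args f) =
    (k`!)%:R^-1 *: \sum_(s : 'S_k) t.
  rewrite (eq_bigr (fun s : 'S_k => \sum_f t (perm_args f s) *:
     decomposable (basis_args (perm_args f s)))); last first.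
    move=> s _; rewrite {1}tsum; apply: reindex.
    exists (fun f => perm_args f s^-1%g) => f _; apply/ffunP => i; rewrite !ffunE.
      by rewrite permKV.
    by rewrite permK.
  rewrite exchange_big scaler_sumr; apply: eq_bigr => f _.
  rewrite -scalerA; congr (_ *: _); rewrite scaler_sumr; apply: eq_bigr => s _.
  rewrite tE scalerA mulrC; congr (_ *: decomposable _).
  by apply/ffunP => i; rewrite !ffunE.
rewrite sumr_const card_Sn -scaler_nat scalerA mulVf ?scale1r //.
by rewrite pnatr_eq0 -lt0n fact_gt0.
Qed.

Fact multilinear_eq0 (W : lmodType R) (F : {ffun 'I_k -> V} -> W) :
  multilinear_map F -> (forall f, F (basis_args f) = 0) -> forall v, F v = 0.
Proof.
move=> linF F0 v.
suff H n : (n <= k)%N -> forall v, (forall i : 'I_k, (n <= i)%N ->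
    exists j : 'I_(\dim {:V}), v i = e`_j) -> F v = 0.
  by apply: (H k (leqnn k)) => i; rewrite leqNgt ltn_ord.
elim: n => [_ u ub|n IHn lt_nk u ub].
  have /fin_all_exists[f fE] : forall i, exists j : 'I_(\dim {:V}), u i = e`_j.
    by move=> i; apply: ub.
  by rewrite -(F0 (finfun f)); congr F; apply/ffunP => i; rewrite !ffunE.
pose p := Ordinal lt_nk.
pose aM := GRing.isLinear.Build R V W _ (fun x => F (upd u p x)) (linF u p).
pose G : {linear V -> W} := HB.pack (fun x => F (upd u p x)) aM.
have -> : F u = G (u p).
  by rewrite /=; congr F; apply/ffunP => i; rewrite ffunE; case: eqP => // ->.
rewrite (coord_vbasis (memvf (u p))) linear_sum big1 // => j _.
rewrite linearZ /= IHn ?scaler0 1?ltnW // => i le_ni; rewrite ffunE.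
by case: eqVneq => [_|ip]; [exists j | apply: ub; rewrite ltn_neqAle eq_sym ip].
Qed.

Fact alternating_tperm (W : lmodType R) (F : {ffun 'I_k -> V} -> W) v i j :
  multilinear_map F -> alternating_map F -> i != j ->
  F (perm_args v (tperm i j)) = - F v.
Proof.
move=> linF altF ij; pose G x y := F (upd (upd v i x) j y).
have Gdiag x : G x x = 0.
  by apply: (altF _ i j ij); rewrite !ffunE !eqxx (negPf ij).
have GDr x y z : G x (y + z) = G x y + G x z.
  by have := linF (upd v i x) j 1 y z; rewrite !scale1r.
have updC x y : upd (upd v i x) j y = upd (upd v j y) i x.
  apply/ffunP => p; rewrite !ffunE; have [->|//] := eqVneq p j.
  by rewrite eq_sym (negPf ij).
have GDl x y z : G (x + y) z = G x z + G y z.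
  by rewrite /G !updC; have := linF (upd v j z) i 1 x y; rewrite !scale1r.
have Gskew x y : G x y = - G y x.
  have := Gdiag (x + y); rewrite GDl !GDr !Gdiag add0r addr0.
  by move/eqP; rewrite addr_eq0 => /eqP.
have -> : F v = G (v i) (v j).
  congr F; apply/ffunP => p; rewrite !ffunE.
  by case: eqP => [->//|_]; case: eqP => [->|].
rewrite -Gskew; congr F; apply/ffunP => p; rewrite !ffunE.
case: tpermP => [->|->|/eqP/negPf-> /eqP/negPf->//]; rewrite ?eqxx //.
by rewrite (negPf ij).
Qed.

Fact alternating_perm (W : lmodType R) (F : {ffun 'I_k -> V} -> W) v s :
  multilinear_map F -> alternating_map F ->
  F (perm_args v s) = (-1) ^+ s *: F v.
Proof.
move=> linF altF; have [ts -> dts] := prod_tpermP s.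
elim: ts dts v => [_ v|t ts IHts /= /andP[dt dts] v].
  rewrite big_nil odd_perm1 scale1r; congr F; apply/ffunP => i.
  by rewrite ffunE perm1.
have -> : perm_args v (\prod_(u <- t :: ts) tperm u.1 u.2)%g =
    perm_args (perm_args v (\prod_(u <- ts) tperm u.1 u.2)%g) (tperm t.1 t.2).
  by apply/ffunP => i; rewrite !ffunE big_cons permM.
rewrite alternating_tperm // IHts // big_cons odd_permM odd_tperm dt.
by rewrite signr_addb expr1 mulN1r scaleNr.
Qed.

Lemma ext_pow_universal (W : lmodType R) (F : {ffun 'I_k -> V} -> W) :
  multilinear_map F -> alternating_map F ->
  exists L : {linear tensor_pow -> W}, forall v, L (wedge v) = F v.
Proof.
move=> linF altF.
pose L0 (t : tensor_pow) : W := \sum_f ((k`!)%:R^-1 * t f) *: F (basis_args f).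
have L0lin : linear L0.
  move=> a t u; rewrite /L0 scaler_sumr -big_split; apply: eq_bigr => f _.
  by rewrite !ffunE /= mulrDr scalerDl scalerA; congr (_ *: _ + _); apply: mulrCA.
pose aM := GRing.isLinear.Build R tensor_pow W _ L0 L0lin.
have [L LE] : exists L : {linear tensor_pow -> W}, L =1 L0.
  by pose L : {linear tensor_pow -> W} := HB.pack L0 aM; exists L.
have Ldec v : L (decomposable v) = (k`!)%:R^-1 *: F v.
  apply/eqP; rewrite -subr_eq0; apply/eqP; move: v.
  apply: multilinear_eq0 => [v p a x y|f].
    rewrite decomposable_multilinear.
    rewrite linearP linF scalerDr scalerBr !scalerA [_ * a]mulrC.
    by rewrite opprD addrACA.
  rewrite LE /L0 (bigD1 f) //= big1 => [|g /negPf gf].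
    by rewrite decomposable_basis eqxx mulr1 addr0 subrr.
  by rewrite decomposable_basis eq_sym gf mulr0 scale0r.
exists L => v; rewrite /wedge linear_sum.
rewrite (eq_bigr (fun=> (k`!)%:R^-1 *: F v)) => [|s _].
  rewrite sumr_const card_Sn -scaler_nat scalerA divff ?scale1r //.
  by rewrite pnatr_eq0 -lt0n fact_gt0.
rewrite linearZ /= Ldec alternating_perm // !scalerA; congr (_ *: _).
by rewrite mulrAC -signr_addb addbb mul1r.
Qed.

Lemma tensor_act_ext_pow A t : t \in ext_pow -> tensor_act A t \in ext_pow.
Proof.
move=> tE; rewrite (ext_pow_span tE) linear_sum; apply: rpred_sum => f _.
rewrite linearZ /= rpredZ // tensor_act_wedge; apply: rpred_sum => p _.
exact: wedge_in_ext_pow.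
Qed.

Lemma tensor_actP : linear tensor_act.
Proof.
move=> a A B; apply/lfunP => t; rewrite add_lfunE scale_lfunE !lfunE /=.
apply/ffunP=> f; rewrite !ffunE scaler_sumr -big_split; apply: eq_bigr => p _.
rewrite /= scaler_sumr -big_split; apply: eq_bigr => j _ /=.
by rewrite add_lfunE scale_lfunE linearP mulrDr; congr (_ + _); apply: mulrCA.
Qed.

End ExteriorPower.

Definition ext_invariants (R : realType) (g : lieAlgType R) (V : vectType R)
    (k : nat) (rho : g -> 'End(V)) : {vspace tensor_pow k V} :=
  (ext_pow k V :&: rep_invariants (fun x => tensor_act k (rho x)))%VS.

Lemma ext_invariantsP (R : realType) (g : lieAlgType R) (V : vectType R)
    (k : nat) (rho : g -> 'End(V)) (t : tensor_pow k V) : linear rho ->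
  reflect (t \in ext_pow k V /\ forall x, tensor_act k (rho x) t = 0)
          (t \in ext_invariants k rho).
Proof.
move=> lin_rho; rewrite memv_cap.
have lin_act : linear (fun x => tensor_act k (rho x)).
  by move=> a x y; rewrite lin_rho tensor_actP.
by apply: (iffP andP) => -[? /(rep_invariantsP _ lin_act)].
Qed.

(* Main.v *)
Require Import Defs.
From mathcomp Require Import all_boot all_order all_fingroup all_algebra.
From mathcomp Require Import reals.
From mathcomp Require Import boolp classical_sets topology normedtype derive.
From mathcomp Require Import ring lra.

Set Implicit Arguments.
Unset Strict Implicit.
Unset Printing Implicit Defensive.

Import Order.TTheory GRing.Theory Num.Theory.
Local Open Scope ring_scope.

(* Let r0 denote the action of h + sp(1) on m. An invariant Euclidean product
   on m is obtained by a Kempf-Ness argument: among the conjugates of the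
   matrices A_i of r0 on an orthonormal basis, one of minimal norm exists
   because a limit of normalized conjugators is an intertwiner, hence
   invertible by irreducibility. Minimality gives sum [A_i, A_i^T] = 0, and
   then A_j + A_j^T commutes with r0, hence is a scalar since the commutant of
   r0 is R. These scalars are the values of a linear form vanishing on
   brackets, represented by a central element z; r0 z is a scalar which kills a
   nonzero element of Lambda^4 m, so it vanishes.

   The Jacobi identity on m amounts to Om_h + r^-1 Om_s = 0, where Om_h and
   Om_s are the invariant 4-forms obtained by cyclic summation of
   sum_i <A_i v, w> <A_i u, z> over orthonormal bases of h and of sp(1). As
   invariants are one-dimensional, Om_h = c Om_s. Contracting the last two
   arguments with I turns the forms into - 2 <v, I C w> and
   - (dim m + 2) <v, I w>, where C is the Casimir operator of h. As C is
   nonpositive and nonzero, c < 0, so that r = - 1 / c works; conversely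
   2 I C = - ((dim m + 2) / r) I determines r. *)

(** * Euclidean products *)

Section Bilinear.
Variables (R : realType) (U V W : lmodType R) (f : U -> V -> W).
Hypothesis fbil : bilinear_op f.

Lemma bilDl x y v : f (x + y) v = f x v + f y v.
Proof. by have := fbil.1 v 1 x y; rewrite !scale1r. Qed.
Lemma bilDr u x y : f u (x + y) = f u x + f u y.
Proof. by have := fbil.2 u 1 x y; rewrite !scale1r. Qed.
Lemma bil0l v : f 0 v = 0.
Proof. by apply: (addrI (f 0 v)); rewrite -bilDl !addr0. Qed.
Lemma bil0r u : f u 0 = 0.
Proof. by apply: (addrI (f u 0)); rewrite -bilDr !addr0. Qed.
Lemma bilZl a x v : f (a *: x) v = a *: f x v.
Proof. by have := fbil.1 v a x 0; rewrite bil0l !addr0. Qed.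
Lemma bilZr a u y : f u (a *: y) = a *: f u y.
Proof. by have := fbil.2 u a y 0; rewrite bil0r !addr0. Qed.
Lemma bilNl x v : f (- x) v = - f x v.
Proof. by rewrite -scaleN1r bilZl scaleN1r. Qed.
Lemma bilNr u y : f u (- y) = - f u y.
Proof. by rewrite -scaleN1r bilZr scaleN1r. Qed.
Lemma bilBl x y v : f (x - y) v = f x v - f y v.
Proof. by rewrite bilDl bilNl. Qed.
Lemma bilBr u x y : f u (x - y) = f u x - f u y.
Proof. by rewrite bilDr bilNr. Qed.
Lemma bil_suml I (r : seq I) P (F : I -> U) v :
  f (\sum_(i <- r | P i) F i) v = \sum_(i <- r | P i) f (F i) v.
Proof. exact: (big_morph (f^~ v) (fun x y => bilDl x y v) (bil0l v)). Qed.
Lemma bil_sumr I (r : seq I) P (F : I -> V) u :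
  f u (\sum_(i <- r | P i) F i) = \sum_(i <- r | P i) f u (F i).
Proof. exact: (big_morph (f u) (bilDr u) (bil0r u)). Qed.

End Bilinear.

Section EuclideanProducts.
Variables (R : realType) (V : vectType R) (B : V -> V -> R^o).
Hypothesis euB : euclidean_product B.

Lemma euclid_bil : bilinear_op B. Proof. by case: euB. Qed.
Lemma euclidC x y : B x y = B y x. Proof. by case: euB. Qed.
Lemma euclid_gt0 x : x != 0 -> 0 < B x x.
Proof. by case: euB => _ _; apply. Qed.
Lemma euclid_ge0 x : 0 <= B x x.
Proof.
by have [->|/euclid_gt0/ltW//] := eqVneq x 0; rewrite (bil0l euclid_bil).
Qed.
Lemma euclid_eq0 x : B x x = 0 -> x = 0.
Proof.
by move=> x0; apply/eqP/negPn/negP => /euclid_gt0; rewrite x0 ltxx.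
Qed.
Lemma euclid_inj x y : (forall z, B z x = B z y) -> x = y.
Proof.
move=> xy; apply/eqP; rewrite -subr_eq0; apply/eqP/euclid_eq0.
by rewrite (bilBr euclid_bil) xy subrr.
Qed.

Lemma euclidDl x y z : B (x + y) z = (B x z : R) + B y z.
Proof. exact: bilDl euclid_bil _ _ _. Qed.
Lemma euclidDr x y z : B x (y + z) = (B x y : R) + B x z.
Proof. exact: bilDr euclid_bil _ _ _. Qed.
Lemma euclidBl x y z : B (x - y) z = (B x z : R) - B y z.
Proof. exact: bilBl euclid_bil _ _ _. Qed.
Lemma euclidBr x y z : B x (y - z) = (B x y : R) - B x z.
Proof. exact: bilBr euclid_bil _ _ _. Qed.
Lemma euclidNl x y : B (- x) y = - (B x y : R).
Proof. exact: bilNl euclid_bil _ _. Qed.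
Lemma euclidNr x y : B x (- y) = - (B x y : R).
Proof. exact: bilNr euclid_bil _ _. Qed.
Lemma euclidZl a x y : B (a *: x) y = a * (B x y : R).
Proof. exact: bilZl euclid_bil _ _ _. Qed.
Lemma euclidZr a x y : B x (a *: y) = a * (B x y : R).
Proof. exact: bilZr euclid_bil _ _ _. Qed.
Lemma euclid_suml I (r : seq I) P (F : I -> V) v :
  B (\sum_(i <- r | P i) F i) v = \sum_(i <- r | P i) (B (F i) v : R).
Proof. exact: bil_suml euclid_bil _ _ _ _ _. Qed.
Lemma euclid_sumr I (r : seq I) P (F : I -> V) v :
  B v (\sum_(i <- r | P i) F i) = \sum_(i <- r | P i) (B v (F i) : R).
Proof. exact: bil_sumr euclid_bil _ _ _ _ _. Qed.

Definition orthonormal n (o : 'I_n -> V) :=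
  forall i j, B (o i) (o j) = (i == j)%:R.

Definition orthonormal_basis n (o : 'I_n -> V) :=
  orthonormal o /\ forall x, x = \sum_i (B (o i) x : R) *: o i.

(** Gram-Schmidt: a family of fewer than [\dim {:V}] vectors does not span, and the normalized
    residue of a vector outside its span extends it. *)
Lemma exists_orthonormal_basis :
  exists o : 'I_(\dim {:V}) -> V, orthonormal_basis o.
Proof.
have H n : (n <= \dim {:V})%N -> exists o : 'I_n -> V, orthonormal o.
  elim: n => [_|n IHn lt_n]; first by exists (fun=> 0) => -[].
  have [o oo] := IHn (ltnW lt_n); pose X := [tuple o i | i < n].
  have /subvPn[v _ vX] : ~~ ({:V} <= <<X>>)%VS.
    apply: contraL lt_n => /dimvS le_n; rewrite -leqNgt (leq_trans le_n) //.
    by rewrite (leq_trans (dim_span _)) // size_tuple.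
  pose w := v - \sum_i (B (o i) v : R) *: o i.
  have w0 : w != 0.
    apply: contraNneq vX => /eqP; rewrite subr_eq0 => /eqP ->.
    apply: rpred_sum => i _; rewrite rpredZ // memv_span //.
    by apply/tnthP; exists i; rewrite tnth_mktuple.
  have ow j : B (o j) w = 0.
    rewrite /w euclidBr euclid_sumr (bigD1 j) //= big1 => [|i ij].
      by rewrite euclidZr oo eqxx mulr1 addr0 subrr.
    by rewrite euclidZr oo eq_sym (negPf ij) mulr0.
  pose a := (Num.sqrt (B w w : R))^-1.
  exists (fun i => if unlift ord_max i is Some j then o j else a *: w) => i j.
  case: unliftP => [i' ->|->]; case: unliftP => [j' ->|->].
  - by rewrite oo (inj_eq (@lift_inj _ _)).
  - by rewrite euclidZr ow mulr0 eq_sym (negPf (neq_lift _ _)).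
  - by rewrite euclidZl euclidC ow mulr0 (negPf (neq_lift _ _)).
  - rewrite eqxx euclidZl euclidZr mulrA -expr2 exprVn sqr_sqrtr ?euclid_ge0 //.
    by rewrite mulVf // gt_eqF // euclid_gt0.
have [o oo] := H _ (leqnn _); exists o; split=> //.
pose X := [tuple o i | i < \dim {:V}].
have Xo (i : 'I_(\dim {:V})) : X`_i = o i by rewrite -tnth_nth tnth_mktuple.
have Xfree : free X.
  apply/freeP => k k0 i; have := congr1 (B (o i)) k0.
  rewrite (bil0r euclid_bil) euclid_sumr (bigD1 i) //= big1 => [|j ji].
    by rewrite Xo euclidZr oo eqxx mulr1 addr0.
  by rewrite Xo euclidZr oo eq_sym (negPf ji) mulr0.
have Xb : basis_of {:V} X.
  by rewrite basisEfree Xfree subvf size_tuple leqnn.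
move=> x; rewrite {1}(coord_basis Xb (memvf x)); apply: eq_bigr => i _.
rewrite Xo; congr (_ *: _); rewrite {2}(coord_basis Xb (memvf x)).
rewrite euclid_sumr (bigD1 i) //= big1 => [|j ji].
  by rewrite Xo euclidZr oo eqxx mulr1 addr0.
by rewrite Xo euclidZr oo eq_sym (negPf ji) mulr0.
Qed.

Lemma parseval n (o : 'I_n -> V) x y : orthonormal_basis o ->
  B x y = \sum_i (B x (o i) : R) * B (o i) y.
Proof.
move=> [_ oE]; rewrite {1}(oE y) euclid_sumr; apply: eq_bigr => i _.
by rewrite euclidZr mulrC.
Qed.

End EuclideanProducts.

(** * Conjugates of minimal norm *)

Definition mxsqnorm (R : realType) n (X : 'M[R]_n) : R := \tr (X *m X^T).

Lemma mxsqnormE (R : realType) n (X : 'M[R]_n) :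
  mxsqnorm X = \sum_i \sum_j X i j ^+ 2.
Proof.
by apply: eq_bigr => i _; rewrite mxE; apply: eq_bigr => j _; rewrite mxE expr2.
Qed.

Lemma mxsqnorm_ge0 (R : realType) n (X : 'M[R]_n) : 0 <= mxsqnorm X.
Proof. by rewrite mxsqnormE; do 2!apply: sumr_ge0 => ? _; rewrite sqr_ge0. Qed.

Lemma mxsqnorm_eq0 (R : realType) n (X : 'M[R]_n) :
  (mxsqnorm X == 0) = (X == 0).
Proof.
apply/idP/eqP => [|->]; last by rewrite /mxsqnorm mul0mx mxtrace0.
rewrite mxsqnormE psumr_eq0 => [/allP X0|i _]; last first.
  by apply: sumr_ge0 => j _; rewrite sqr_ge0.
apply/matrixP => i j; have := X0 i (mem_index_enum _).
rewrite /= psumr_eq0 => [/allP/(_ j (mem_index_enum _))|? _]; last exact: sqr_ge0.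
by rewrite /= sqrf_eq0 mxE => /eqP.
Qed.

Lemma sqr_entry_le_mxsqnorm (R : realType) n (X : 'M[R]_n) i j :
  X i j ^+ 2 <= mxsqnorm X.
Proof.
rewrite mxsqnormE (bigD1 i) //= (bigD1 j) //= -addrA lerDl addr_ge0 //.
  by apply: sumr_ge0 => ? _; rewrite sqr_ge0.
by do 2!apply: sumr_ge0 => ? _; rewrite sqr_ge0.
Qed.

Lemma mxsqnormZ (R : realType) n a (X : 'M[R]_n) :
  mxsqnorm (a *: X) = a ^+ 2 * mxsqnorm X.
Proof.
rewrite !mxsqnormE mulr_sumr; apply: eq_bigr => i _; rewrite mulr_sumr.
by apply: eq_bigr => j _; rewrite mxE exprMn.
Qed.

(** * Minima of continuous functions on closed bounded sets of coordinates *)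

Section Compactness.
Local Open Scope classical_set_scope.
Import numFieldNormedType.Exports.
Variables (R : realType) (J : choiceType).
Local Notation coords := (prod_topology (fun _ : J => R : topologicalType)).

Lemma coords_continuous (j : J) : continuous (fun x : coords => x j : R).
Proof. exact: (@proj_continuous _ (fun _ : J => R : topologicalType) j). Qed.

Lemma continuous_sumr (T : topologicalType) (I : finType) (F : I -> T -> R) :
  (forall i, continuous (F i)) -> continuous (fun x => \sum_i F i x).
Proof.
by move=> cF; apply: continuous_big => [|i _]; [exact: add_continuous|exact: cF].
Qed.

Lemma continuous_mulr (T : topologicalType) (F G : T -> R) :
  continuous F -> continuous G -> continuous (fun x => F x * G x).
Proof. by move=> cF cG x; exact: (continuousM (cF x) (cG x)). Qed.

(** The set lies in a product of segments, which is compact by Tychonoff's theorem. *)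
Lemma exists_min_closed_box (C : R) (S : set coords) (f : coords -> R) :
  S !=set0 -> closed S -> (forall x j, S x -> `|x j| <= C) -> continuous f ->
  exists2 x, S x & forall y, S y -> f x <= f y.
Proof.
move=> S0 Scl Sb fc.
have cS : compact S.
  apply: (subclosed_compact Scl (@tychonoff J (fun=> R : topologicalType)
    (fun=> `[- C, C]) (fun=> @segment_compact _ _ _))).
  by move=> x Sx j /=; rewrite in_itv /= -ler_norml; apply: Sb.
have [x] := compact_EVT_min S0 cS (continuous_subspaceT fc).
by rewrite inE => Sx fx; exists x => // y Sy; apply: fx; rewrite inE.
Qed.

End Compactness.

(** * Minimizing the norm over the conjugates of an irreducible family *)

Section MinimalConjugate.
Variables (R : realType) (n N : nat) (A : 'I_N -> 'M[R]_n).
Hypothesis n_gt0 : (0 < n)%N.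
Hypothesis irrA : forall U : 'M[R]_n,
  (forall i, (U *m A i <= U)%MS) -> U = 0 \/ row_full U.

(** Schur's argument: the kernel of [g] is stable under every [A i], hence zero or everything. *)
Lemma intertwiner_unit (g : 'M[R]_n) (B : 'I_N -> 'M[R]_n) :
  (forall i, A i *m g = g *m B i) -> g != 0 -> g \in unitmx.
Proof.
move=> gAB; rewrite -row_free_unit -kermx_eq0 => g0.
have [|->//|kfull] := irrA (U := kermx g).
  by move=> i; rewrite sub_kermx -mulmxA gAB mulmxA mulmx_ker mul0mx.
have : (1%:M <= kermx g)%MS by rewrite sub1mx.
by rewrite sub_kermx mul1mx (negPf g0).
Qed.

Import numFieldNormedType.Exports.

(** The minimum is taken over pairs [(g, B)] with [A i *m g = g *m B i] and [g] of norm 1. These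
    equations define a closed set, whereas invertibility of [g] would not; [intertwiner_unit]
    recovers it at the minimum. *)
Lemma exists_minimal_conjugate : exists (g : 'M[R]_n) (B : 'I_N -> 'M[R]_n),
  [/\ g \in unitmx, forall i, A i *m g = g *m B i &
      forall q, q \in unitmx ->
        \sum_i mxsqnorm (B i) <= \sum_i mxsqnorm (invmx q *m B i *m q)].
Proof.
pose J := (('I_n * 'I_n) + ('I_N * ('I_n * 'I_n)))%type.
pose coords := prod_topology (fun _ : J => R : topologicalType).
pose gx (x : coords) : 'M[R]_n := \matrix_(i, j) x (inl (i, j)).
pose Bx (x : coords) k : 'M[R]_n := \matrix_(i, j) x (inr (k, (i, j))).
pose mkx (g : 'M[R]_n) (B : 'I_N -> 'M[R]_n) : coords := fun j : J =>
  match j with inl (i, j) => g i j | inr (k, (i, j)) => B k i j end.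
have gxK g B : gx (mkx g B) = g by apply/matrixP => i j; rewrite mxE.
have BxK g B k : Bx (mkx g B) k = B k by apply/matrixP => i j; rewrite mxE.
pose f x := \sum_i mxsqnorm (Bx x i).
(* The norm of [A] itself: the bound [f x <= C] makes the domain bounded and still admits the pair
   [(1, A)], up to rescaling. *)
pose C := \sum_i mxsqnorm (A i).
have C_ge0 : 0 <= C by apply: sumr_ge0 => i _; exact: mxsqnorm_ge0.
have cg i j : continuous (fun x => gx x i j).
  have -> : (fun x => gx x i j) = (fun x : coords => x (inl (i, j))).
    by apply/funext => x; rewrite mxE.
  exact: coords_continuous.
have cB k i j : continuous (fun x => Bx x k i j).
  have -> : (fun x => Bx x k i j) = (fun x : coords => x (inr (k, (i, j)))).
    by apply/funext => x; rewrite mxE.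
  exact: coords_continuous.
have csq (h : coords -> 'M[R]_n) : (forall i j, continuous (fun x => h x i j)) ->
    continuous (fun x => mxsqnorm (h x)).
  move=> ch; under [X in continuous X]eq_fun do rewrite mxsqnormE.
  do 2!apply: continuous_sumr => ?; under [X in continuous X]eq_fun do rewrite expr2.
  exact: continuous_mulr.
have cf : continuous f by apply: continuous_sumr => k; apply: csq.
have ceq k i j : continuous (fun x => (A k *m gx x - gx x *m Bx x k) i j).
  have -> : (fun x => (A k *m gx x - gx x *m Bx x k) i j) =
      (fun x => \sum_l A k i l * gx x l j - \sum_l gx x i l * Bx x k l j).
    by apply/funext => x; rewrite !mxE.
  have c1 : continuous (fun x => \sum_l A k i l * gx x l j).
    apply: continuous_sumr => l; apply: continuous_mulr; last exact: cg.
    exact: cst_continuous.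
  have c2 : continuous (fun x => \sum_l gx x i l * Bx x k l j).
    by apply: continuous_sumr => l; apply: continuous_mulr; [exact: cg|exact: cB].
  by move=> x; exact: (continuousB (c1 x) (c2 x)).
pose S : set coords := [set x | [/\ mxsqnorm (gx x) = 1, f x <= C &
  forall p : 'I_N * ('I_n * 'I_n),
    (A p.1 *m gx x - gx x *m Bx x p.1) p.2.1 p.2.2 = 0]]%classic.
have SP x : S x <-> [/\ mxsqnorm (gx x) = 1, f x <= C &
    forall i, A i *m gx x = gx x *m Bx x i].
  split=> -[? ? E]; split=> //.
    move=> k; apply/eqP; rewrite -subr_eq0; apply/eqP/matrixP => i j.
    by rewrite (E (k, (i, j))) mxE.
  by move=> p; rewrite E subrr mxE.
have Smk (g : 'M[R]_n) (B : 'I_N -> 'M[R]_n) : g != 0 ->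
    (forall i, A i *m g = g *m B i) ->
    \sum_i mxsqnorm (B i) <= C -> exists2 x, S x & f x = \sum_i mxsqnorm (B i).
  move=> g0 gB BC; have sg : 0 < mxsqnorm g.
    by rewrite lt_neqAle eq_sym mxsqnorm_eq0 g0 mxsqnorm_ge0.
  pose a := (Num.sqrt (mxsqnorm g))^-1.
  have fE : f (mkx (a *: g) B) = \sum_i mxsqnorm (B i).
    by apply: eq_bigr => i _; rewrite BxK.
  exists (mkx (a *: g) B); rewrite // SP fE gxK; split=> // [|i].
    by rewrite mxsqnormZ exprVn sqr_sqrtr ?mulVf ?gt_eqF ?ltW.
  by rewrite BxK -scalemxAr gB scalemxAl.
(* Squares of entries are at most 1 for [g] and at most [C] for [B], so at most [C + 1]; as [C + 1]
   is at least 1, it also bounds the entries. *)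
have [|||x Sx xmin] := @exists_min_closed_box R J (C + 1) S f _ _ _ cf.
- have [|i||x Sx _] := Smk 1%:M A => //; last by exists x.
    by rewrite -mxrank_eq0 mxrank1 -lt0n.
  by rewrite mulmx1 mul1mx.
- have -> : S = ((fun x => mxsqnorm (gx x)) @^-1` [set x | x = 1] `&`
      f @^-1` [set x | x <= C] `&` \bigcap_p
        (fun x => (A p.1 *m gx x - gx x *m Bx x p.1) p.2.1 p.2.2)
          @^-1` [set x | x = 0])%classic.
    apply/seteqP; split=> y; first by move=> [? ? E]; split=> // p _; apply: E.
    by move=> [[? ?] E]; split=> // p; apply: E.
  apply: closedI; first apply: closedI.
  + apply: preimage_closed; last exact: closed_eq.
    by move=> y _; apply: csq.
  + apply: preimage_closed; last exact: closed_le.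
    by move=> y _; apply: cf.
  + apply: closed_bigI => p _; apply: preimage_closed; last exact: closed_eq.
    by move=> y _; apply: ceq.
- move=> y j [y1 yC _].
  have : `|y j| ^+ 2 <= C + 1.
    rewrite real_normK ?num_real //; case: j => [[i j]|[k [i j]]].
      have -> : y (inl (i, j)) = gx y i j by rewrite mxE.
      by rewrite (le_trans (sqr_entry_le_mxsqnorm _ _ _)) // y1 lerDr.
    have -> : y (inr (k, (i, j))) = Bx y k i j by rewrite mxE.
    rewrite (le_trans (sqr_entry_le_mxsqnorm _ _ _)) //.
    apply: (@le_trans _ _ (f y)); last by rewrite (le_trans yC) ?lerDl.
    rewrite /f (bigD1 k) //= lerDl; apply: sumr_ge0 => ? _; exact: mxsqnorm_ge0.
  by have := normr_ge0 (y j); move: C_ge0; nra.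
case/SP: (Sx) => x1 xC xE.
have x0 : gx x != 0 by rewrite -mxsqnorm_eq0 x1 oner_eq0.
have xu : gx x \in unitmx by exact: intertwiner_unit xE x0.
exists (gx x), (Bx x); split=> // q qu.
(* A conjugate of norm above [C] cannot beat [f x <= C]; any other one, paired with [gx x *m q],
   gives a point of [S] after rescaling. *)
have [qC|/ltW] := leP (\sum_i mxsqnorm (invmx q *m Bx x i *m q)) C; last first.
  exact: le_trans.
have [||//|y Sy <-] := Smk (gx x *m q) (fun i => invmx q *m Bx x i *m q).
- apply: contraNneq x0 => xq0; have := mulmxK qu (gx x).
  by rewrite xq0 mul0mx => <-.
- move=> i; rewrite !mulmxA xE -[gx x *m q *m invmx q]mulmxA mulmxV //.
  by rewrite mulmx1.
- exact: xmin.
Qed.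

End MinimalConjugate.

Lemma trmxD (R : realType) m n (X Y : 'M[R]_(m, n)) : (X + Y)^T = X^T + Y^T.
Proof. exact: linearD. Qed.

Lemma trmxB (R : realType) m n (X Y : 'M[R]_(m, n)) : (X - Y)^T = X^T - Y^T.
Proof. exact: linearB. Qed.

Lemma mxtraceB (R : realType) n (X Y : 'M[R]_n) : \tr (X - Y) = \tr X - \tr Y.
Proof. exact: raddfB. Qed.

(** * First variation at a family of minimal norm *)

Section Normality.
Variables (R : realType) (n N : nat) (B : 'I_N -> 'M[R]_n).
Hypothesis minB : forall q, q \in unitmx ->
  \sum_i mxsqnorm (B i) <= \sum_i mxsqnorm (invmx q *m B i *m q).

(** With [D = x - y] and [E = x - z], the expression at [s = 1 + d] is [d * (D + d * E)], negative
    for small [d] of sign opposite to a nonzero [D]. *)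
Lemma eq_of_quadratic_ge0 (x y z : R) :
  (forall s, 0 < s -> 0 <= (s - 1) * (s * x - y - (s - 1) * z)) -> x = y.
Proof.
move=> H; apply/eqP; rewrite -subr_eq0; apply/eqP.
set D := x - y; pose E := x - z; pose k := `|D| + `|E| + 1.
have D0 := normr_ge0 D; have E0 := normr_ge0 E.
have k0 : 0 < k by rewrite /k; lra.
(* Then [D = - 2 * (d * k)] and the expression becomes [d ^+ 2 * (E - 2 * k)], where [k] was chosen
   so that [2 * k] exceeds [E]. *)
pose d := - D / (2 * k).
have dk : d * k = - D / 2 by rewrite /d; field; rewrite gt_eqF.
have d1 : 0 < 1 + d.
  have := ler_norm D; rewrite -(pmulr_lgt0 _ k0) mulrDl dk mul1r /k; lra.
have := H _ d1; rewrite [1 + d - 1]addrAC subrr add0r.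
have -> : (1 + d) * x - y - d * z = D + d * E by rewrite /D /E; ring.
have -> : D = - 2 * (d * k) by rewrite dk; field.
move=> ge0; have := ler_norm E => EE; suff : d = 0 by move=> ->; ring.
have : 0 <= d ^+ 2 * (E - 2 * k) by move: ge0; congr (_ <= _); ring.
have : E - 2 * k < 0 by rewrite /k; lra.
move=> lt0; rewrite nmulr_lge0 // => /(conj (sqr_ge0 d))/andP.
by rewrite -eq_le eq_sym sqrf_eq0 => /eqP.
Qed.

(* First variation along the conjugations by 1 + (sqrt s - 1) P. *)
Lemma minimal_projection (P : 'M[R]_n) : P *m P = P -> P^T = P ->
  \tr (P *m \sum_i (B i)^T *m B i) = \tr (P *m \sum_i B i *m (B i)^T).
Proof.
move=> PP PT; rewrite !mulmx_sumr !raddf_sum /=.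
apply: (@eq_of_quadratic_ge0 _ _ (\sum_i \tr (P *m B i *m P *m (B i)^T))).
move=> s s0; pose t := Num.sqrt s.
have t0 : 0 < t by rewrite sqrtr_gt0.
have ts : t * t = s by rewrite -expr2 sqr_sqrtr ?ltW.
have comb (a b : R) : (1%:M + a *: P) *m (1%:M + b *: P) =
    1%:M + (a + b + a * b) *: P.
  rewrite mulmxDl mul1mx mulmxDr mulmx1 -scalemxAl -scalemxAr PP scalerA.
  by rewrite -addrA -!scalerDl; congr (_ + _ *: _); ring.
pose q := 1%:M + (t - 1) *: P; pose q' := 1%:M + (t^-1 - 1) *: P.
have qq' : q *m q' = 1%:M.
  rewrite comb (_ : _ + _ * _ = 0 :> R) ?scale0r ?addr0 //.
  by field; rewrite gt_eqF.
have qu : q \in unitmx by case: (mulmx1_unit qq').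
have iq : invmx q = q'.
  by rewrite -[LHS]mulmx1 -qq' mulmxA mulVmx // mul1mx.
have qT : q^T = q by rewrite /q trmxD linearZ /= PT trmx1.
have q'T : q'^T = q' by rewrite /q' trmxD linearZ /= PT trmx1.
have := minB qu; rewrite -subr_ge0 -sumrB iq.
(* By cyclicity of the trace [q] and [q'] enter only through their squares, so the variation is
   rational in [s] and free of [t]. *)
have E i : mxsqnorm (q' *m B i *m q) - mxsqnorm (B i) =
   (s - 1) * \tr (P *m ((B i)^T *m B i)) + (s^-1 - 1) * \tr (P *m (B i *m (B i)^T))
   + (s - 1) * (s^-1 - 1) * \tr (P *m B i *m P *m (B i)^T).
  rewrite /mxsqnorm !trmx_mul qT q'T.
  have -> : \tr (q' *m B i *m q *m (q *m ((B i)^T *m q'))) =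
      \tr ((q' *m q') *m B i *m (q *m q) *m (B i)^T).
    by rewrite !mulmxA mxtrace_mulC !mulmxA.
  have -> : q *m q = 1%:M + (s - 1) *: P.
    by rewrite comb -ts; congr (_ + _ *: _); ring.
  have -> : q' *m q' = 1%:M + (s^-1 - 1) *: P.
    by rewrite comb -ts; congr (_ + _ *: _); field; rewrite gt_eqF.
  rewrite mulmxDr mulmx1 !mulmxDl !mul1mx -?scalemxAr -?scalemxAl.
  rewrite !mxtraceD !mxtraceZ.
  have -> : \tr (P *m ((B i)^T *m B i)) = \tr (B i *m P *m (B i)^T).
    by rewrite mulmxA mxtrace_mulC mulmxA.
  by rewrite !mulmxA; ring.
rewrite (eq_bigr _ (fun i _ => E i)) !big_split /= -!mulr_sumr => ge0.
set x := \sum_i \tr _ in ge0 *; set y := \sum_i \tr _ in ge0 *.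
set z := \sum_i \tr _ in ge0 *.
have -> : (s - 1) * (s * x - y - (s - 1) * z) =
   s * ((s - 1) * x + (s^-1 - 1) * y + (s - 1) * (s^-1 - 1) * z).
  by field; rewrite gt_eqF.
by rewrite mulr_ge0 // ltW.
Qed.

(** The difference [M] is symmetric, and by [minimal_projection] it has zero trace against every
    orthogonal projection of rank one. Its quadratic form therefore vanishes, and polarization kills
    its entries. *)
Lemma minimal_normal : \sum_i (B i)^T *m B i = \sum_i B i *m (B i)^T.
Proof.
apply/eqP; rewrite -subr_eq0; set M := _ - _.
have MT : M^T = M.
  have e1 : (\sum_i (B i)^T *m B i)^T = \sum_i (B i)^T *m B i.
    by rewrite linear_sum; apply: eq_bigr => i _; rewrite /= trmx_mul trmxK.
  have e2 : (\sum_i B i *m (B i)^T)^T = \sum_i B i *m (B i)^T.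
    by rewrite linear_sum; apply: eq_bigr => i _; rewrite /= trmx_mul trmxK.
  by rewrite /M trmxB e1 e2.
have Mu (u : 'cV[R]_n) : \tr (u *m u^T *m M) = 0.
  pose c := (u^T *m u) 0 0.
  have uu : u^T *m u = c%:M by apply/matrixP => i j; rewrite !ord1 [RHS]mxE eqxx.
  have [c0|c0] := eqVneq c 0.
    have -> : u = 0; last by rewrite mul0mx mul0mx mxtrace0.
    apply/matrixP => i j; rewrite !ord1 !mxE; apply/eqP.
    move/eqP: c0; rewrite /c mxE psumr_eq0 => [/allP/(_ i (mem_index_enum _))|k _].
      by rewrite /= mxE mulf_eq0 orbb.
    by rewrite mxE -expr2 sqr_ge0.
  pose P := c^-1 *: (u *m u^T).
  have -> : u *m u^T = c *: P by rewrite scalerA divff ?scale1r.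
  rewrite -scalemxAl mxtraceZ mulmxBr mxtraceB minimal_projection ?subrr ?mulr0 //.
    rewrite /P -scalemxAl -scalemxAr -mulmxA [u^T *m _]mulmxA uu.
    by rewrite mul_scalar_mx -scalemxAr !scalerA mulVf ?mulr1.
  by rewrite linearZ /= trmx_mul trmxK.
clearbody M.
have Muu (u : 'cV[R]_n) : u^T *m M *m u = 0.
  apply/matrixP => i j; rewrite !ord1 [RHS]mxE -(Mu u) -[u *m u^T *m M]mulmxA.
  by rewrite [RHS]mxtrace_mulC /mxtrace big_ord_recl big_ord0 addr0.
pose d k : 'cV[R]_n := delta_mx k 0.
have Mij i j : ((d i)^T *m M *m d j) 0 0 = M i j.
  by rewrite trmx_delta -rowE -colE !mxE.
apply/eqP/matrixP => i j; rewrite [RHS]mxE.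
have := Muu (d i + d j); rewrite trmxD !mulmxDl !mulmxDr !Muu add0r addr0.
move/matrixP/(_ 0 0); rewrite !mxE /=.
have := Mij i j; have := Mij j i; rewrite !mxE => -> ->.
have -> : M j i = M i j by rewrite -[in LHS]MT mxE.
lra.
Qed.

End Normality.

(** * Symmetric parts of a minimal family closed under brackets *)

Section Commuting.
Variables (R : realType) (n N : nat) (A : 'I_N -> 'M[R]_n).
Variable c : 'I_N -> 'I_N -> 'I_N -> R.
Hypothesis c_skew : forall i j k, c i j k = - c i k j.
Hypothesis A_lie : forall i j,
  A i *m A j - A j *m A i = \sum_k c i j k *: A k.
Hypothesis A_normal : \sum_i (A i)^T *m A i = \sum_i A i *m (A i)^T.

Local Notation br X Y := (X *m Y - Y *m X).

(** Adjunction for the product [\tr (Y *m Z^T)]: the transpose of ad X is ad of [X^T]. *)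
Lemma mxtrace_br_adj (X Y Z : 'M[R]_n) :
  \tr (br X Y *m Z^T) = \tr (Y *m (br X^T Z)^T).
Proof.
rewrite trmxB !trmx_mul trmxK mulmxBl mulmxBr !mxtraceB; congr (_ - _).
  by rewrite -mulmxA mxtrace_mulC mulmxA.
by rewrite !mulmxA.
Qed.

Lemma mulmx_jacobi (X Y Z : 'M[R]_n) :
  br X (br Z Y) - br Z (br X Y) = br (br X Z) Y.
Proof.
rewrite !mulmxBl !mulmxBr !mulmxA.
move: (X *m Z *m Y) (X *m Y *m Z) (Z *m Y *m X) (Y *m Z *m X)
  (Z *m X *m Y) (Y *m X *m Z) => p q r s t u.
by apply/matrixP => a b; rewrite !mxE; ring.
Qed.

(* Writing ad and c_j for the actions on tuples of matrices, the operator X =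
   ad A_j - c_j kills the tuple A, hence |X^T A|^2 = <[X, X^T] A, A>, which is
   the trace of [A_j, A_j^T] against sum_i [A_i, A_i^T] = 0. *)
Lemma normal_symmetric_part_commutes j i :
  (A j + (A j)^T) *m A i = A i *m (A j + (A j)^T).
Proof.
pose P := A j + (A j)^T; pose W k := br P (A k).
have PT : P^T = P by rewrite /P trmxD trmxK addrC.
suff W0 : \sum_k mxsqnorm (W k) = 0.
  move/eqP: W0; rewrite psumr_eq0 => [/allP/(_ i (mem_index_enum _))|k _].
    by rewrite /= mxsqnorm_eq0 subr_eq0 => /eqP.
  exact: mxsqnorm_ge0.
(* The right side is the transpose of the operator X of the comment above, applied to the tuple [A]:
   skewness of [c j] turns its sign into a plus. *)
have WE k : W k = br (A j)^T (A k) + \sum_l c j k l *: A l.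
  by rewrite -A_lie /W /P !mulmxDl !mulmxDr opprD addrACA addrC.
have cW k : \sum_l c j k l *: W l = br P (br (A j) (A k)).
  rewrite A_lie mulmx_sumr mulmx_suml -sumrB; apply: eq_bigr => l _.
  by rewrite -scalemxAr -scalemxAl scalerBr.
have jacobi k : br (A j) (W k) - br P (br (A j) (A k)) = br (br (A j) P) (A k).
  exact: mulmx_jacobi.
transitivity (\sum_k \tr (A k *m (br (br (A j) P) (A k))^T)).
  rewrite /mxsqnorm.
  transitivity (\sum_k (\tr (A k *m (br (A j) (W k))^T)
      + \sum_l c j k l * \tr (A l *m (W k)^T))).
    apply: eq_bigr => k _; rewrite {1}WE mulmxDl mxtraceD mxtrace_br_adj trmxK.
    congr (_ + _); rewrite mulmx_suml raddf_sum; apply: eq_bigr => l _ /=.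
    by rewrite -scalemxAl mxtraceZ.
  rewrite big_split /= [X in _ + X]exchange_big -big_split /=; apply: eq_bigr => k _.
  rewrite -jacobi (trmxB (br (A j) (W k))) [in RHS](mulmxBr (A k)) mxtraceB; congr (_ + _).
  rewrite -cW.
  rewrite [(\sum_l _)^T]linear_sum mulmx_sumr [\tr (\sum_l _)]linear_sum -sumrN /=.
  apply: eq_bigr => l _.
  by rewrite c_skew mulNr [(_ *: _)^T]linearZ /= -scalemxAr mxtraceZ.
have -> : br (A j) P = br (A j) (A j)^T.
  rewrite /P mulmxDr mulmxDl; apply/matrixP => a b; rewrite !mxE; ring.
set D := br (A j) (A j)^T.
have DT : D^T = D by rewrite /D trmxB !trmx_mul trmxK.
clearbody D.
(* Cyclicity moves the bracket with [D] onto the commutator of [A k] and its transpose. *)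
transitivity (\tr (D *m (\sum_k A k *m (A k)^T - \sum_k (A k)^T *m A k))).
  rewrite -sumrB mulmx_sumr raddf_sum; apply: eq_bigr => k _ /=.
  rewrite trmxB !trmx_mul DT !mulmxBr !mxtraceB; congr (_ - _).
    by rewrite mulmxA mxtrace_mulC.
  by rewrite mxtrace_mulC mulmxA.
by rewrite A_normal subrr mulmx0 mxtrace0.
Qed.

End Commuting.

(** * Invariant Euclidean products *)

Lemma lieC (R : realType) (l : lieAlgType R) (x y : l) : lie x y = - lie y x.
Proof.
have lb := @lie_bilinear R l; have := liexx (x + y).
rewrite (bilDl lb) !(bilDr lb) !liexx add0r addr0 => /eqP.
by rewrite addr_eq0 => /eqP.
Qed.

Lemma linear_sum_scale (R : realType) (U V : lmodType R) (f : U -> V) I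
    (r : seq I) (P : pred I) (a : I -> R) (F : I -> U) : linear f ->
  f (\sum_(i <- r | P i) a i *: F i) = \sum_(i <- r | P i) a i *: f (F i).
Proof.
move=> lf; have f0 : f 0 = 0.
  by apply: (addrI (f 0)); have := lf 1 0 0; rewrite !scale1r !addr0.
elim/big_rec2: _ => [|i y x _ <-]; [exact: f0|exact: lf].
Qed.

Lemma euclidean_mulmx_tr (R : realType) (V : vectType R) n (phi : V -> 'rV[R]_n) :
  linear phi -> injective phi ->
  euclidean_product (fun x y => (phi x *m (phi y)^T) 0 0 : R^o).
Proof.
move=> lphi phi_inj; have phi0 : phi 0 = 0.
  by apply: (addrI (phi 0)); have := lphi 1 0 0; rewrite !scale1r !addr0.
split=> [|x y|x x0].
- split=> [v a x y|u a x y]; rewrite lphi.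
    by rewrite mulmxDl -scalemxAl !mxE.
  by rewrite [(_ + _)^T]linearP mulmxDr -scalemxAr !mxE.
- by rewrite !mxE; apply: eq_bigr => i _; rewrite !mxE mulrC.
have E : (phi x *m (phi x)^T) 0 0 = \sum_i phi x 0 i ^+ 2.
  by rewrite mxE; apply: eq_bigr => i _; rewrite mxE expr2.
have ge0 : 0 <= \sum_i phi x 0 i ^+ 2.
  by apply: sumr_ge0 => i _; exact: sqr_ge0.
rewrite E lt_neqAle ge0 andbT eq_sym; apply: contra x0.
rewrite psumr_eq0 => [/allP phix0|i _]; last exact: sqr_ge0.
apply/eqP/phi_inj; rewrite phi0; apply/rowP => i; rewrite mxE.
by have := phix0 i (mem_index_enum _); rewrite /= sqrf_eq0 => /eqP.
Qed.

Section SymmetricPart.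
Import passmx.
Variables (R : realType) (l : lieAlgType R) (B : l -> l -> R^o).
Variables (V : vectType R) (rho : l -> 'End(V)).
Hypotheses (euB : euclidean_product B) (adB : ad_invariant B).
Hypothesis irr : irreducible_rep rho.

(** The dot product of row vectors is pulled back along [phi], the coordinates followed by the
    minimal conjugator [g]; there [rho x] acts by a combination [S x] of the minimal matrices
    [D i]. *)
Lemma exists_product_symmetric_part_commutes :
  exists2 Bm : V -> V -> R^o, euclidean_product Bm &
    forall x, exists2 P : 'End(V), commutes_with rho P &
      forall v w, Bm (rho x v) w + Bm v (rho x w) = Bm (P v) w.
Proof.
have [[lrho rhoL] V0 irrU] := irr.
have [eps [epso epsE]] := exists_orthonormal_basis euB.
pose e := vbasis {:V}; have eb : basis_of {:V} e := vbasisP _.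
pose A i := mxof e e (rho (eps i)).
have rhoE x : rho x = \sum_i (B (eps i) x : R) *: rho (eps i).
  by rewrite {1}(epsE x) linear_sum_scale.
have n_gt0 : (0 < \dim {:V})%N by rewrite lt0n dimv_eq0.
have irrA (U : 'M[R]_(\dim {:V})) :
    (forall i, (U *m A i <= U)%MS) -> U = 0 \/ row_full U.
  move=> UA; have [x|U0|Ufull] := irrU (vsof e U).
  - rewrite rhoE; apply/subvP => _ /memv_imgP[v vU ->].
    rewrite sum_lfunE rpred_sum // => i _; rewrite scale_lfunE rpredZ //.
    move: vU; rewrite -!(rVof_sub eb) (rVof_app e eb) => vU.
    exact: submx_trans (submxMr _ vU) (UA i).
  - by left; apply/eqP; rewrite -(vsof_eq0 eb) U0.
  right; rewrite -sub1mx; apply/row_subP => i.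
  by rewrite -[row _ _](vecofK eb) (rVof_sub eb) Ufull memvf.
(* Structure constants with [i] and [j] exchanged: matrices act on row vectors from the right, so
   [mxof] reverses compositions. Ad-invariance of [B] makes them skew. *)
pose c i j k : R := B (eps k) (lie (eps j) (eps i)).
have c_skew i j k : c i j k = - c i k j.
  by rewrite /c -adB lieC (euclidNl euB) adB.
have A_lie i j : A i *m A j - A j *m A i = \sum_k c i j k *: A k.
  rewrite -!(mxof_comp e e eb) -linearB -rhoL rhoE linear_sum.
  by apply: eq_bigr => k _; rewrite linearZ.
have [g [D [gu AgD minD]]] := exists_minimal_conjugate n_gt0 irrA.
have DE i : D i = invmx g *m A i *m g by rewrite -mulmxA AgD mulKmx.
have D_lie i j : D i *m D j - D j *m D i = \sum_k c i j k *: D k.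
  have DD p q : D p *m D q = invmx g *m (A p *m A q) *m g.
    by rewrite !DE !mulmxA mulmxK.
  rewrite !DD -mulmxBl -mulmxBr A_lie mulmx_sumr mulmx_suml.
  by apply: eq_bigr => k _; rewrite -scalemxAr -scalemxAl DE.
have DC := normal_symmetric_part_commutes c_skew D_lie (minimal_normal minD).
pose phi x := rVof e x *m g.
have lphi : linear phi by move=> a x y; rewrite /phi linearP mulmxDl -scalemxAl.
have phi_inj : injective phi.
  apply: (can_inj (g := fun u => vecof e (u *m invmx g))) => x.
  by rewrite mulmxK // rVofK.
exists (fun x y => (phi x *m (phi y)^T) 0 0); first exact: euclidean_mulmx_tr.
pose S x := \sum_i (B (eps i) x : R) *: D i.
have phi_rho x v : phi (rho x v) = phi v *m S x.
  rewrite rhoE sum_lfunE mulmx_sumr /phi linear_sum mulmx_suml.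
  apply: eq_bigr => i _; rewrite scale_lfunE linearZ -scalemxAl -scalemxAr.
  by rewrite /= (rVof_app e eb) -mulmxA AgD mulmxA.
have ST x : S x + (S x)^T = \sum_i (B (eps i) x : R) *: (D i + (D i)^T).
  rewrite [(S x)^T]linear_sum -big_split; apply: eq_bigr => i _.
  by rewrite /= linearZ scalerDr.
have SC x y : (S x + (S x)^T) *m S y = S y *m (S x + (S x)^T).
  rewrite ST mulmx_suml mulmx_sumr; apply: eq_bigr => i _.
  rewrite -scalemxAl -scalemxAr; congr (_ *: _).
  rewrite mulmx_suml mulmx_sumr; apply: eq_bigr => j _.
  by rewrite -scalemxAl -scalemxAr DC.
(* The symmetric part of [S x], carried back to [V] through [phi]. *)
move=> x; pose P : 'End(V) := hommx e e (g *m (S x + (S x)^T) *m invmx g).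
have phiP v : phi (P v) = phi v *m (S x + (S x)^T).
  by rewrite /phi -(rVof_mul eb eb) !mulmxA mulmxKV.
exists P => [y|v w].
  apply/lfunP => v; rewrite !comp_lfunE; apply: phi_inj.
  by rewrite phi_rho !phiP phi_rho -!mulmxA SC.
rewrite phiP !phi_rho; move: (phi v) (phi w) (S x) => a b s.
by rewrite trmx_mul mulmxDr mulmxDl mulmxA [RHS]mxE.
Qed.
End SymmetricPart.

Lemma coord_vbasis_inj (R : realType) (V : vectType R) (v w : V) :
  (forall i, coord (vbasis {:V}) i v = coord (vbasis {:V}) i w) -> v = w.
Proof.
move=> vw; rewrite (coord_vbasis (memvf v)) (coord_vbasis (memvf w)).
by apply: eq_bigr => i _; rewrite vw.
Qed.

(** Serves to turn an identity between vectors into one between scalars, within reach of [ring]; the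
    coordinate forms already separate vectors. *)
Lemma linear_functionals_inj (R : realType) (V : vectType R) (v w : V) :
  (forall f : V -> R, (forall x y, f (x + y) = f x + f y) ->
    (forall a x, f (a *: x) = a * f x) -> (forall x, f (- x) = - f x) ->
    f v = f w) -> v = w.
Proof.
move=> vw; apply: coord_vbasis_inj => i.
by apply: vw => *; rewrite ?linearD ?linearZ ?linearN.
Qed.

Section LfunLinear.
Variables (R : realType) (U V : vectType R) (T : 'Hom(U, V)).
Lemma lfunD x y : T (x + y) = T x + T y. Proof. exact: linearD. Qed.
Lemma lfun0 : T 0 = 0. Proof. exact: linear0. Qed.
Lemma lfunN x : T (- x) = - T x. Proof. exact: linearN. Qed.
Lemma lfunZ a x : T (a *: x) = a *: T x. Proof. exact: linearZ. Qed.
End LfunLinear.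

(** Leibniz rule: each of the [k] slots contributes a factor [c]. *)
Lemma tensor_act_scalar (R : realType) k (V : vectType R) (c : R)
    (t : tensor_pow k V) : tensor_act k (c *: \1%VF) t = (k%:R * c) *: t.
Proof.
apply/ffunP => f; rewrite lfunE !ffunE /=.
rewrite (eq_bigr (fun=> c * t f)) => [|p _].
  by rewrite sumr_const card_ord -scalerA scaler_nat.
rewrite (bigD1 (f p)) //= big1 ?addr0 => [|j jp].
  rewrite scale_lfunE id_lfunE linearZ /= coord_free ?(basis_free (vbasisP _)) //.
  rewrite eqxx mulr1 mulrC; congr (_ * t _).
  by apply/ffunP => i; rewrite ffunE; case: eqP => [->|].
rewrite scale_lfunE id_lfunE linearZ /= coord_free ?(basis_free (vbasisP _)) //.
by rewrite (negPf jp) mulr0 mulr0.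
Qed.

Section InvariantProduct.
Variables (R : realType) (l : lieAlgType R) (B : l -> l -> R^o).
Variables (V : vectType R) (rho : l -> 'End(V)).
Hypotheses (euB : euclidean_product B) (adB : ad_invariant B).
Hypothesis irr : irreducible_rep rho.
Hypothesis schur : forall T, commutes_with rho T -> exists c, T = c *: \1%VF.

(** Once Schur's lemma has made each symmetric part a scalar, the remaining obstruction is a central
    element acting by a nonzero scalar; it could not kill the tensor [t] of positive degree. *)
Lemma exists_invariant_product k (t : tensor_pow k V) : (0 < k)%N -> t != 0 ->
    (forall x, tensor_act k (rho x) t = 0) ->
  exists2 Bm : V -> V -> R^o, euclidean_product Bm & rep_invariant rho Bm.
Proof.
move=> k_gt0 t0 t_inv; have [[lrho rhoL] V0 _] := irr.
have [Bm euBm Bm_sym] := exists_product_symmetric_part_commutes euB adB irr.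
exists Bm => //; pose v0 := vpick {:V}.
have v0_neq0 : v0 != 0 by rewrite vpick0.
have nv0 : (Bm v0 v0 : R) != 0 by rewrite gt_eqF // euclid_gt0.
(* The scalar by which [rho x] fails to be skew, read off at [v0]; an explicit formula makes its
   linearity a computation. *)
pose lam x : R := (Bm (rho x v0) v0 + Bm v0 (rho x v0)) / Bm v0 v0.
have lamE x v w : (Bm (rho x v) w : R) = lam x * Bm v w - Bm v (rho x w).
  have [P /schur[c ->] PE] := Bm_sym x.
  have E u u' : (Bm (rho x u) u' : R) + Bm u (rho x u') = c * Bm u u'.
    by have := PE u u'; rewrite scale_lfunE id_lfunE (euclidZl euBm).
  by rewrite /lam E mulfK // -E addrK.
have lam_lin : linear (lam : l -> R^o).
  move=> a x y; rewrite /lam lrho add_lfunE scale_lfunE.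
  rewrite !(euclidDl euBm, euclidDr euBm, euclidZl euBm, euclidZr euBm) /=.
  by rewrite -[_ *: _]/(a * _); ring.
have lam_lie x y : lam (lie x y) = 0.
  rewrite /lam rhoL !add_lfunE !opp_lfunE !comp_lfunE.
  rewrite !(euclidBl euBm, euclidBr euBm) !(lamE x, lamE y).
  set a := (Bm _ _ : R); set b := (Bm _ _ : R).
  by rewrite -(mul0r (Bm v0 v0 : R)^-1); congr (_ / _); ring.
have [eps [epso epsE]] := exists_orthonormal_basis euB.
pose z := \sum_i lam (eps i) *: eps i.
have zE x : B z x = lam x :> R.
  rewrite (euclid_suml euB) {2}(epsE x) (linear_sum_scale _ _ _ _ lam_lin).
  by apply: eq_bigr => i _; rewrite (euclidZl euB) mulrC.
have z_central x : lie z x = 0.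
  apply: (euclid_inj euB) => y; rewrite (bil0r (euclid_bil euB)) (euclidC euB) adB zE.
  exact: lam_lie.
have [c rho_z] : exists c, rho z = c *: \1%VF.
  apply: schur => x; apply/eqP; rewrite -subr_eq0 -rhoL z_central.
  by have := lrho (-1) 0 0; rewrite scaler0 addr0 scaleN1r addNr => ->.
have c0 : c = 0.
  have := t_inv z; rewrite rho_z tensor_act_scalar => /eqP.
  rewrite scaler_eq0 (negPf t0) orbF mulf_eq0 pnatr_eq0 -leqn0 leqNgt k_gt0.
  by move/eqP.
have z0 : z = 0.
  apply: (euclid_eq0 euB); rewrite zE /lam rho_z c0 scale0r zero_lfunE.
  by rewrite (bil0l (euclid_bil euBm)) (bil0r (euclid_bil euBm)) addr0 mul0r.
move=> x v w; have -> : (Bm (rho x v) w + Bm v (rho x w) : R) = lam x * Bm v w.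
  by rewrite lamE subrK.
by rewrite -zE z0 (bil0l (euclid_bil euB)) mul0r.
Qed.

End InvariantProduct.

(** * Quaternionic structures and the commutant of h + sp(1) *)

Section Quaternionic.
Variables (R : realType) (h : lieAlgType R) (m : vectType R).
Variables (rho : h -> 'End(m)) (I J K : 'End(m)).
Hypothesis quatIJK : quaternionic_structure rho I J K.

Lemma quaternionic_relations v :
  [/\ I (I v) = - v, J (J v) = - v & K (K v) = - v] /\
  [/\ I (J v) = K v, J (K v) = I v, K (I v) = J v &
  [/\ J (I v) = - K v, K (J v) = - I v & I (K v) = - J v]].
Proof.
have [_ [II JJ KK IJK]] := quatIJK.
have ev (T S : 'End(m)) u : (T \o S)%VF = - \1%VF -> T (S u) = - u.
  by move/lfunP/(_ u); rewrite comp_lfunE opp_lfunE id_lfunE.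
have iiE u := ev _ _ u II; have jjE u := ev _ _ u JJ; have kkE u := ev _ _ u KK.
have ijk u : I (J (K u)) = - u by have := ev _ _ u IJK; rewrite comp_lfunE.
have ij u : I (J u) = K u.
  by have := ijk (K u); rewrite kkE !linearN => /oppr_inj.
have jk u : J (K u) = I u.
  by have := iiE (J (K u)); rewrite ijk linearN => /oppr_inj.
(* As K = I J squares to -1, I J I J = -1, hence J I J = I; evaluating this at [J u] gives the
   claim. *)
have ji u : J (I u) = - K u.
  have H w : J (I (J w)) = I w.
    have := kkE w; rewrite -!ij => E.
    by have := iiE (J (I (J w))); rewrite E linearN => /oppr_inj.
  by have := H (J u); rewrite jjE !linearN ij => /eqP; rewrite eqr_oppLR => /eqP.
have ik u : I (K u) = - J u by rewrite -ij iiE.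
have ki u : K (I u) = J u.
  by rewrite -[K (I u)]ij ji linearN /= ik opprK.
have kj u : K (J u) = - I u by rewrite -ij jjE linearN.
by split; split.
Qed.

(** Applying the conjugate a - b I - c J - d K to the relation leaves the sum of squares times
    [v]. *)
Lemma quaternionic_free v a b c d : v != 0 ->
  a *: v + b *: I v + c *: J v + d *: K v = 0 -> [/\ a = 0, b = 0, c = 0 & d = 0].
Proof.
move=> v0 y0; have [[ii jj kk] [ij jk ki [ji kj ik]]] := quaternionic_relations v.
have : (a ^+ 2 + b ^+ 2 + c ^+ 2 + d ^+ 2) *: v = 0.
  pose y := a *: v + b *: I v + c *: J v + d *: K v.
  transitivity (a *: y - b *: I y - c *: J y - d *: K y); last first.
    by rewrite /y y0 !(linear0, scaler0, oppr0, addr0).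
  rewrite /y !(lfunD, lfunZ) ii jj kk ij jk ki ji kj ik.
  apply: linear_functionals_inj => f fD fZ fN; rewrite !(fD, fZ, fN).
  ring.
move/eqP; rewrite scaler_eq0 (negPf v0) orbF => /eqP s0.
have := sqr_ge0 a; have := sqr_ge0 b; have := sqr_ge0 c; have := sqr_ge0 d.
by move=> d0 c0 b0 a0; split; apply/eqP; rewrite -sqrf_eq0; apply/eqP; lra.
Qed.

Lemma rep_plus_sp1E x v : rep_plus_sp1 rho I J K x v =
  rho x.1 v + x.2 0 0 *: I v + x.2 0 1 *: J v + x.2 0 2 *: K v.
Proof. by rewrite !add_lfunE !scale_lfunE. Qed.

Hypothesis irr : irreducible_rep rho.

Lemma rep_plus_sp1_l x : rep_plus_sp1 rho I J K (x, 0) = rho x.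
Proof. by apply/lfunP => v; rewrite rep_plus_sp1E /= !mxE !scale0r !addr0. Qed.

Lemma rep_plus_sp1_r u v : rep_plus_sp1 rho I J K (0, u) v =
  u 0 0 *: I v + u 0 1 *: J v + u 0 2 *: K v.
Proof.
have [[lrho _] _ _] := irr; rewrite rep_plus_sp1E /=.
have -> : rho 0 = 0.
  by have := lrho (-1) 0 0; rewrite scaler0 addr0 scaleN1r addNr.
by rewrite zero_lfunE add0r.
Qed.

Lemma rep_plus_sp1_rep : representation (rep_plus_sp1 rho I J K).
Proof.
have [[lrho rhoL] _ _] := irr; have [[cI cJ cK] _] := quatIJK.
split=> [a x y|x y]; apply/lfunP => v.
  rewrite [RHS]add_lfunE [in RHS]scale_lfunE !rep_plus_sp1E lrho add_lfunE.
  rewrite scale_lfunE.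
  apply: linear_functionals_inj => f fD fZ fN; rewrite !(fD, fZ, fN) !mxE.
  ring.
have cE T : commutes_with rho T -> forall x v, T (rho x v) = rho x (T v).
  by move=> cT z w; have /lfunP/(_ w) := cT z; rewrite !comp_lfunE.
have [[ii jj kk] [ij jk ki [ji kj ik]]] := quaternionic_relations v.
rewrite [RHS]add_lfunE [in RHS]opp_lfunE !comp_lfunE.
rewrite (rep_plus_sp1E (lie x y)) /= rhoL add_lfunE opp_lfunE !comp_lfunE.
rewrite !rep_plus_sp1E !(lfunD, lfunZ).
rewrite !(cE _ cI, cE _ cJ, cE _ cK) ii jj kk ij jk ki ji kj ik.
rewrite (_ : lie x.2 y.2 = sp1_lie x.2 y.2) // sp1_lieE !mxE /=.
apply: linear_functionals_inj => f fD fZ fN; rewrite !(fD, fZ, fN).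
ring.
Qed.

Lemma rep_plus_sp1_irreducible : irreducible_rep (rep_plus_sp1 rho I J K).
Proof.
have [_ m0 mU] := irr; split=> // [|U Ust]; first exact: rep_plus_sp1_rep.
by apply: mU => x; rewrite -rep_plus_sp1_l.
Qed.

Hypothesis quat_rho : quaternionic_type rho.

(** The commutant of h is the span of 1, I, J, K, and commuting with I and J leaves only the
    scalars. *)
Lemma rep_plus_sp1_schur T :
  commutes_with (rep_plus_sp1 rho I J K) T -> exists c, T = c *: \1%VF.
Proof.
move=> cT; have [_ [phi [_ _ phi_inj phiP]]] := quat_rho.
have [_ m0 _] := irr; pose v0 := vpick {:m}.
have v0_neq0 : v0 != 0 by rewrite vpick0.
pose X := [tuple \1%VF; I; J; K].
have Xfree : free X.
  apply/freeP => k; rewrite !big_ord_recl big_ord0 addr0 /= => /lfunP/(_ v0).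
  rewrite !add_lfunE !scale_lfunE id_lfunE zero_lfunE !addrA => /quaternionic_free.
  case=> // k0 k1 k2 k3 i; case: i => [[|[|[|[|//]]]] lt4].
  - by rewrite -[RHS]k0; congr k; apply: val_inj.
  - by rewrite -[RHS]k1; congr k; apply: val_inj.
  - by rewrite -[RHS]k2; congr k; apply: val_inj.
  - by rewrite -[RHS]k3; congr k; apply: val_inj.
have [[cI cJ cK] _] := quatIJK.
(* The isomorphism [phi] need not send the units to I, J, K. The commutant has dimension at most 4
   as an image of the quaternions, and contains a free family of four elements. *)
have XW : (<<X>> == limg (linfun phi))%VS.
  have dim_phi : (\dim (limg (linfun phi)) <= 4)%N.
    have := leq_addl (\dim ({:quat R} :&: lker (linfun phi))) (\dim (limg (linfun phi))).
    by rewrite limg_ker_dim dimvf.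
  rewrite eqEdim (eqP Xfree) size_tuple dim_phi andbT.
  apply/span_subvP => S; rewrite !inE => /or4P[] /eqP ->.
  - have /phiP[q ->] : commutes_with rho \1%VF.
      by move=> x; rewrite comp_lfun1l comp_lfun1r.
    by apply/memv_imgP; exists q; rewrite ?memvf ?lfunE.
  - by have /phiP[q ->] := cI; apply/memv_imgP; exists q; rewrite ?memvf ?lfunE.
  - by have /phiP[q ->] := cJ; apply/memv_imgP; exists q; rewrite ?memvf ?lfunE.
  - by have /phiP[q ->] := cK; apply/memv_imgP; exists q; rewrite ?memvf ?lfunE.
have TX : T \in <<X>>%VS.
  have /phiP[q ->] : commutes_with rho T.
    by move=> x; have := cT (x, 0); rewrite rep_plus_sp1_l.
  by rewrite (eqP XW); apply/memv_imgP; exists q; rewrite ?memvf ?lfunE.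
have [a [b [c [d TE]]]] : exists a b c d, forall v,
    T v = a *: v + b *: I v + c *: J v + d *: K v.
  rewrite (coord_span TX) !big_ord_recl big_ord0 addr0 /=.
  eexists; eexists; eexists; eexists => v.
  by rewrite !add_lfunE !scale_lfunE id_lfunE !addrA.
have TR u v : T (rep_plus_sp1 rho I J K (0, u) v) = rep_plus_sp1 rho I J K (0, u) (T v).
  by have /lfunP/(_ v) := cT (0, u); rewrite !comp_lfunE.
have [[ii jj kk] [ij jk ki [ji kj ik]]] := quaternionic_relations v0.
have TI : T (I v0) = I (T v0).
  have := TR (delta_mx 0 0) v0; rewrite !rep_plus_sp1_r !mxE /=.
  by rewrite !scale0r !scale1r !addr0.
have TJ : T (J v0) = J (T v0).
  have := TR (delta_mx 0 1) v0; rewrite !rep_plus_sp1_r !mxE /=.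
  by rewrite !scale0r !scale1r !addr0 !add0r.
(* The four entries are the coefficients of the commutator [I, T] on 1, I, J, K; the same is then
   done with J to obtain [b]. *)
have [_ _ c0 d0] : [/\ 0 = 0 :> R, 0 = 0 :> R, - (2 * d) = 0 & 2 * c = 0].
  apply: (quaternionic_free v0_neq0); transitivity (I (T v0) - T (I v0)); last first.
    by rewrite TI subrr.
  rewrite !TE !(lfunD, lfunZ) ?(ii, jj, kk, ij, jk, ki, ji, kj, ik).
  apply: linear_functionals_inj => f fD fZ fN; rewrite !(fD, fZ, fN).
  ring.
have [_ _ _ b0] : [/\ 0 = 0 :> R, 2 * d = 0, 0 = 0 :> R & - (2 * b) = 0].
  apply: (quaternionic_free v0_neq0); transitivity (J (T v0) - T (J v0)); last first.
    by rewrite TJ subrr.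
  rewrite !TE !(lfunD, lfunZ) ?(ii, jj, kk, ij, jk, ki, ji, kj, ik).
  apply: linear_functionals_inj => f fD fZ fN; rewrite !(fD, fZ, fN).
  ring.
exists a; apply/lfunP => v; rewrite TE scale_lfunE id_lfunE.
have -> : b = 0 by lra.
have -> : c = 0 by lra.
have -> : d = 0 by lra.
by rewrite !scale0r !addr0.
Qed.

End Quaternionic.

(** * Tensors and forms *)

Section FormTensor.
Variables (R : realType) (k : nat) (V : vectType R) (Bm : V -> V -> R^o).
Hypothesis euBm : euclidean_product Bm.
Local Notation n := (\dim {:V}).
Local Notation e := (vbasis {:V}).

(** Riesz representatives of the coordinate forms. Tensors are stored by their coordinates in
    [vbasis {:V}], which need not be orthonormal for [Bm]. *)
Lemma exists_dual_vectors :
  exists d : 'I_n -> V, forall i x, Bm (d i) x = coord e i x :> R.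
Proof.
have [o oP] := exists_orthonormal_basis euBm.
exists (fun i => \sum_a coord e i (o a) *: o a) => i x.
rewrite (euclid_suml euBm) {2}(oP.2 x) linear_sum; apply: eq_bigr => a _.
by rewrite (euclidZl euBm) linearZ /= mulrC.
Qed.

Variable d : 'I_n -> V.
Hypothesis dE : forall i x, Bm (d i) x = coord e i x :> R.

Lemma dual_expand x : x = \sum_(j < n) (Bm x e`_j : R) *: d j.
Proof.
apply: (euclid_inj euBm) => z; rewrite (euclidC euBm).
rewrite (euclid_sumr euBm) {1}(coord_vbasis (memvf z)) (euclid_sumr euBm).
apply: eq_bigr => j _.
by rewrite !(euclidZr euBm) (euclidC euBm z) dE mulrC.
Qed.

(** The tensor matching the form [F] when [Bm] identifies V with its dual: taking coordinates means
    applying coordinate forms, which the vectors [d i] represent. *)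
Definition form_tensor (F : {ffun 'I_k -> V} -> R^o) : tensor_pow k V :=
  [ffun f : {ffun 'I_k -> 'I_n} => F [ffun i => d (f i)]].

Lemma form_tensor_ext_pow F : multilinear_map F -> alternating_map F ->
  form_tensor F \in ext_pow k V.
Proof.
move=> Fm Fa; apply/ext_powP => s f; rewrite !ffunE.
transitivity (F (perm_args [ffun i => d (f i)] s)).
  by congr F; apply/ffunP => i; rewrite !ffunE.
exact: alternating_perm.
Qed.

(** For skew [X] the coordinates of the image are minus the values of the derivative of [F] along
    [X]: skewness moves [X] from the basis onto the dual vectors. *)
Lemma form_tensor_act F (X : 'End(V)) : multilinear_map F ->
  (forall v w, Bm (X v) w + Bm v (X w) = 0) ->
  (forall v, \sum_p F (upd v p (X (v p))) = 0) ->
  tensor_act k X (form_tensor F) = 0.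
Proof.
move=> Fm Xskew Finv; apply/ffunP => f; rewrite lfunE !ffunE.
pose w := [ffun i => d (f i)] : {ffun 'I_k -> V}.
transitivity (- \sum_p F (upd w p (X (w p)))); last by rewrite Finv oppr0.
rewrite -sumrN; apply: eq_bigr => p _.
rewrite {1}(dual_expand (X (w p))) (linear_sum_scale _ _ _ _ (Fm w p)) -sumrN.
apply: eq_bigr => j _; rewrite ffunE -dE -[_ *: _]/(_ * _) mulrC -mulNr.
congr (_ * F _).
  have /eqP := Xskew (w p) e`_j; rewrite addr_eq0 => /eqP ->.
  by rewrite opprK ffunE.
by apply/ffunP => i; rewrite !ffunE; case: eqP.
Qed.

Lemma form_tensor_inj F G c : multilinear_map F -> multilinear_map G ->
  form_tensor F = c *: form_tensor G -> forall v, F v = c * G v.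
Proof.
move=> Fm Gm FG v.
(* The map taking the basis to the dual vectors is onto, with section [sigma]. Composing with it
   reduces the claim to [multilinear_eq0] on basis vectors. *)
pose theta x := \sum_(j < n) coord e j x *: d j.
have theta_lin : linear theta.
  move=> a x y; rewrite /theta scaler_sumr -big_split; apply: eq_bigr => j _.
  by rewrite linearP scalerDl scalerA.
pose sigma x := \sum_(j < n) (Bm x e`_j : R) *: e`_j.
have sigmaK x : theta (sigma x) = x.
  rewrite [RHS](dual_expand x); apply: eq_bigr => j _; congr (_ *: _).
  by rewrite coord_sum_free ?(basis_free (vbasisP _)).
pose H v := F [ffun i => theta (v i)] - c * G [ffun i => theta (v i)] : R^o.
have Hm : multilinear_map H.
  move=> w p a x y.
  have E z : [ffun i => theta (upd w p z i)] = upd [ffun i => theta (w i)] p (theta z).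
    by apply/ffunP => i; rewrite !ffunE; case: eqP.
  rewrite /H !E theta_lin Fm Gm mulrDr opprD addrACA scalerBr.
  by congr (_ - _ + _); rewrite -![_ *: _]/(_ * _) mulrCA.
have Hb f : H (basis_args f) = 0.
  have E : [ffun i => theta (basis_args f i)] = [ffun i => d (f i)].
    apply/ffunP => i; rewrite !ffunE /theta (bigD1 (f i)) //= big1 ?addr0 => [|j ji].
      by rewrite coord_free ?(basis_free (vbasisP _)) // eqxx scale1r.
    by rewrite coord_free ?(basis_free (vbasisP _)) // eq_sym (negPf ji) scale0r.
  have /ffunP/(_ f) := FG; rewrite !ffunE /H E => ->.
  by rewrite -[_ *: _]/(_ * _) subrr.
have vE : v = [ffun i => theta ([ffun i => sigma (v i)] i)].
  by apply/ffunP => i; rewrite !ffunE sigmaK.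
by have /eqP := multilinear_eq0 Hm Hb [ffun i => sigma (v i)];
  rewrite /H -vE subr_eq0 => /eqP.
Qed.

End FormTensor.

Lemma ord4_ind (P : 'I_4 -> Prop) : P 0 -> P 1 -> P 2 -> P 3 -> forall i, P i.
Proof.
move=> P0 P1 P2 P3; case=> [[|[|[|[|//]]]] lt4].
- by have -> : Ordinal lt4 = 0 by exact: val_inj.
- by have -> : Ordinal lt4 = 1 by exact: val_inj.
- by have -> : Ordinal lt4 = 2 by exact: val_inj.
- by have -> : Ordinal lt4 = 3 by exact: val_inj.
Qed.

Lemma sum_ord4 (V : nmodType) (G : 'I_4 -> V) : \sum_p G p = G 0 + G 1 + G 2 + G 3.
Proof.
rewrite 4!big_ord_recl big_ord0 addr0 !addrA.
by congr (_ + G _ + G _ + G _); apply: val_inj.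
Qed.

(** * The 4-form attached to a family of skew endomorphisms *)

Section BianchiForm.
Variables (R : realType) (V : vectType R) (Bm : V -> V -> R^o).
Hypothesis euBm : euclidean_product Bm.
Variables (N : nat) (A : 'I_N -> 'End(V)).
Hypothesis A_skew : forall i v w, Bm (A i v) w = - Bm v (A i w).

Definition square_form (v0 v1 v2 v3 : V) : R :=
  \sum_i (Bm (A i v0) v1 : R) * Bm (A i v2) v3.

(** The defect in the first Bianchi identity for [square_form], which has the pair symmetries of a
    curvature tensor. *)
Definition bianchi_form (v0 v1 v2 v3 : V) : R :=
  square_form v0 v1 v2 v3 + square_form v1 v2 v0 v3 + square_form v2 v0 v1 v3.

Definition bianchi_map (v : {ffun 'I_4 -> V}) : R^o :=
  bianchi_form (v 0) (v 1) (v 2) (v 3).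

Lemma skew_formC i v w : Bm (A i v) w = - (Bm (A i w) v : R).
Proof. by rewrite A_skew (euclidC euBm). Qed.

Lemma square_form_skewl v0 v1 v2 v3 :
  square_form v1 v0 v2 v3 = - square_form v0 v1 v2 v3.
Proof. by rewrite -sumrN; apply: eq_bigr => i _; rewrite skew_formC mulNr. Qed.
Lemma square_formC v0 v1 v2 v3 : square_form v2 v3 v0 v1 = square_form v0 v1 v2 v3.
Proof. by apply: eq_bigr => i _; rewrite mulrC. Qed.
Lemma square_form0l v v2 v3 : square_form v v v2 v3 = 0.
Proof. by have := square_form_skewl v v v2 v3; lra. Qed.
Lemma square_form0r v v2 v3 : square_form v2 v3 v v = 0.
Proof. by rewrite square_formC square_form0l. Qed.

Lemma square_formP0 a x y v1 v2 v3 : square_form (a *: x + y) v1 v2 v3 =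
  a * square_form x v1 v2 v3 + square_form y v1 v2 v3.
Proof.
rewrite mulr_sumr -big_split; apply: eq_bigr => i _ /=.
by rewrite lfunD lfunZ (euclidDl euBm) (euclidZl euBm); ring.
Qed.
Lemma square_formP1 a x y v1 v2 v3 : square_form v1 (a *: x + y) v2 v3 =
  a * square_form v1 x v2 v3 + square_form v1 y v2 v3.
Proof. by rewrite 3!(square_form_skewl _ v1) square_formP0; ring. Qed.
Lemma square_formP2 a x y v1 v2 v3 : square_form v1 v2 (a *: x + y) v3 =
  a * square_form v1 v2 x v3 + square_form v1 v2 y v3.
Proof. by rewrite 3!(square_formC _ _ v1) square_formP0. Qed.
Lemma square_formP3 a x y v1 v2 v3 : square_form v1 v2 v3 (a *: x + y) =
  a * square_form v1 v2 v3 x + square_form v1 v2 v3 y.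
Proof. by rewrite 3!(square_formC _ _ v1) square_formP1. Qed.

Lemma bianchi_map_multilinear : multilinear_map bianchi_map.
Proof.
move=> v p a x y; elim/ord4_ind: p; rewrite /bianchi_map !ffunE -!val_eqE /=;
rewrite /bianchi_form !(square_formP0, square_formP1, square_formP2,
  square_formP3) -[_ *: _]/(_ * _) /=; ring.
Qed.

(** When two arguments agree, one of the three cyclic terms vanishes and the other two cancel by the
    pair symmetries. *)
Lemma bianchi_map_alternating : alternating_map bianchi_map.
Proof.
move=> v i j ij vij; rewrite /bianchi_map /bianchi_form.
have skl a b c d := square_form_skewl a b c d.
have sqC a b c d := square_formC a b c d.
elim/ord4_ind: i ij vij; elim/ord4_ind: j => // _ vij;
  rewrite ?vij -?vij ?square_form0l ?square_form0r ?add0r ?addr0;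
  first [ by rewrite [X in _ + X]skl subrr
        | by rewrite [X in _ + X]skl [X in _ - X]sqC subrr
        | by rewrite [X in _ + X]sqC [X in _ + X]skl subrr ].
Qed.

(** Bracketing with [X] rotates the family [A] infinitesimally through the skew matrix [c], and the
    sum of the squares of the A_i is unchanged by rotations. *)
Lemma bianchi_map_invariant (X : 'End(V)) (c : 'I_N -> 'I_N -> R) :
  (forall v w, Bm (X v) w = - Bm v (X w)) -> (forall i j, c i j = - c j i) ->
  (forall i v, A i (X v) - X (A i v) = \sum_j c i j *: A j v) ->
  forall v, \sum_p bianchi_map (upd v p (X (v p))) = 0.
Proof.
move=> X_skew c_skew AX.
have sq0 v0 v1 v2 v3 : square_form (X v0) v1 v2 v3 + square_form v0 (X v1) v2 v3 +
    square_form v0 v1 (X v2) v3 + square_form v0 v1 v2 (X v3) = 0.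
  have om i v w : (Bm (A i (X v)) w : R) + Bm (A i v) (X w) =
      \sum_j c i j * (Bm (A j v) w : R).
    have -> : Bm (A i v) (X w) = - Bm (X (A i v)) w :> R by rewrite X_skew opprK.
    rewrite -[LHS](euclidBl euBm) AX (euclid_suml euBm); apply: eq_bigr => j _.
    by rewrite (euclidZl euBm).
  (* Differentiating the two factors gives [S] and its mirror image with the indices of [A]
     exchanged; they cancel because [c] is skew. *)
  pose S := \sum_i \sum_j c i j * ((Bm (A j v0) v1 : R) * Bm (A i v2) v3).
  transitivity (S + \sum_i \sum_j c i j * ((Bm (A i v0) v1 : R) * Bm (A j v2) v3)).
    rewrite /S -!big_split; apply: eq_bigr => i _ /=.
    have := om i v0 v1; have := om i v2 v3 => E1 E2.
    transitivity (((Bm (A i (X v0)) v1 : R) + Bm (A i v0) (X v1)) * Bm (A i v2) v3 +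
       (Bm (A i v0) v1 : R) * ((Bm (A i (X v2)) v3 : R) + Bm (A i v2) (X v3))).
      by ring.
    rewrite E1 E2 mulr_suml mulr_sumr; congr (_ + _); apply: eq_bigr => j _; ring.
  rewrite exchange_big -big_split /= big1 // => i _.
  rewrite -big_split big1 // => j _ /=; rewrite [c j i]c_skew; ring.
move=> v; rewrite [LHS]sum_ord4 /bianchi_map !ffunE -!val_eqE /= /bianchi_form.
have := sq0 (v 0) (v 1) (v 2) (v 3); have := sq0 (v 1) (v 2) (v 0) (v 3).
have := sq0 (v 2) (v 0) (v 1) (v 3); lra.
Qed.

(** Of the three cyclic terms one yields a trace of [A i] against [T]; Parseval turns each of the
    other two into the same inner product. *)
Lemma bianchi_contraction n (o : 'I_n -> V) (T : 'End(V)) v w :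
  orthonormal_basis Bm o -> (forall v w, Bm (T v) w = - Bm v (T w)) ->
  \sum_a bianchi_form v w (o a) (T (o a)) =
  \sum_i ((Bm (A i v) w : R) * \sum_a (Bm (A i (o a)) (T (o a)) : R)
    + 2 * (Bm (A i v) (T (A i w)) : R)).
Proof.
move=> oP T_skew; rewrite /bianchi_form !big_split /= /square_form.
rewrite exchange_big [X in _ + X + _]exchange_big [X in _ + X]exchange_big /=.
rewrite -!big_split; apply: eq_bigr => i _ /=; rewrite -addrA; congr (_ + _).
  by rewrite mulr_sumr.
have -> : \sum_a (Bm (A i w) (o a) : R) * Bm (A i v) (T (o a)) =
    Bm (A i v) (T (A i w)).
  have -> : Bm (A i v) (T (A i w)) = - Bm (A i w) (T (A i v)) :> R.
    by rewrite (euclidC euBm) T_skew.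
  have -> : - Bm (A i w) (T (A i v)) = Bm (A i w) (- T (A i v)) :> R.
    by rewrite (euclidNr euBm).
  rewrite (parseval euBm _ _ oP); apply: eq_bigr => a _; congr (_ * _).
  by rewrite (euclidNr euBm) (euclidC euBm (o a)) T_skew opprK.
have -> : \sum_a (Bm (A i (o a)) v : R) * Bm (A i w) (T (o a)) =
    Bm (A i v) (T (A i w)).
  rewrite (parseval euBm _ _ oP); apply: eq_bigr => a _.
  rewrite A_skew (euclidC euBm (o a)) (euclidC euBm _ (T (A i w))) T_skew.
  by rewrite -[X in X * _ = _]/(- (Bm (A i v) (o a) : R)); ring.
by ring.
Qed.

End BianchiForm.

(** * The bracket on l + m *)

Section Bracket.
Variables (R : realType) (l : lieAlgType R) (V : vectType R).
Variables (B : l -> l -> R^o) (Bm : V -> V -> R^o) (rho : l -> 'End(V)).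
Hypotheses (euB : euclidean_product B) (euBm : euclidean_product Bm).
Variable mu : V -> V -> l.
Hypothesis muE : forall a v w, B a (mu v w) = Bm (rho a v) w.

(** Condition (4) forces the bracket on m to be [mu], so a double bracket [v, [w, u]] is
    [- rho (mu w u) v], and Jacobi on m is the stated cyclic identity. *)
Lemma s_bracket_bianchi br :
  representation rho -> s_bracket B rho Bm br -> jacobi_identity br ->
  forall v w u, rho (mu v w) u + rho (mu w u) v + rho (mu u v) w = 0.
Proof.
move=> [lrho _] [_ brC [_ br_lm br_mm2 br_mm1]] br_jac v w u.
have br_mm x y : br (0, x) (0, y) = (mu x y, 0).
  rewrite [LHS]surjective_pairing br_mm2; congr pair; apply: (euclid_inj euB) => a.
  by rewrite br_mm1 muE.
have E x y z : br (0, x) (br (0, y) (0, z)) = (0, - rho (mu y z) x).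
  by rewrite br_mm brC br_lm; congr pair; rewrite /= oppr0.
have := congr1 snd (br_jac (0, v) (0, w) (0, u)); rewrite !E /= => /eqP.
rewrite -!opprD oppr_eq0 => /eqP <-.
by rewrite [RHS]addrC addrA.
Qed.

(** The remaining cases of Jacobi hold automatically: they express Jacobi in l, the representation
    property and the equivariance of [mu]. *)
Lemma s_representation_of_bianchi :
  ad_invariant B -> irreducible_rep rho -> rep_invariant rho Bm ->
  (forall v w u, rho (mu v w) u + rho (mu w u) v + rho (mu u v) w = 0) ->
  s_representation B rho.
Proof.
move=> adB irr inv bianchi; have [[lrho rhoL] _ _] := irr.
have skew a v w : Bm (rho a v) w = - (Bm v (rho a w) : R).
  by apply/eqP; rewrite -addr_eq0; apply/eqP; exact: inv.
have mu_bil : bilinear_op mu.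
  split=> [v a x y|u a x y]; apply: (euclid_inj euB) => z.
    rewrite (euclidDr euB) (euclidZr euB) !muE lfunD lfunZ.
    by rewrite (euclidDl euBm) (euclidZl euBm).
  by rewrite (euclidDr euB) (euclidZr euB) !muE (euclidDr euBm) (euclidZr euBm).
have muC v w : mu v w = - mu w v.
  apply: (euclid_inj euB) => z; rewrite (euclidNr euB) !muE skew.
  by rewrite (euclidC euBm).
(* Equivariance comes from ad-invariance of [B] together with skewness of [rho a]. *)
have mu_equiv a v w : lie a (mu v w) = mu (rho a v) w + mu v (rho a w).
  apply: (euclid_inj euB) => b; rewrite -adB (euclidDr euB) !muE rhoL.
  rewrite add_lfunE opp_lfunE !comp_lfunE (euclidBl euBm); congr (_ + _).
  by rewrite (skew a) opprK.
have lb := @lie_bilinear R l.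
have rhoD x y v : rho (x + y) v = rho x v + rho y v.
  by have := lrho 1 x y; rewrite !scale1r => ->; rewrite add_lfunE.
have rho0 v : rho 0 v = 0.
  by apply: (addrI (rho 0 v)); rewrite -rhoD !addr0.
have rhoZ a x v : rho (a *: x) v = a *: rho x v.
  by have /lfunP/(_ v) := lrho a x 0; rewrite add_lfunE scale_lfunE rho0 !addr0.
split=> //; exists Bm; split=> //.
pose br (x y : (l * V)%type) : (l * V)%type :=
  (lie x.1 y.1 + mu x.2 y.2, rho x.1 y.2 - rho y.1 x.2).
exists br; split; last first.
  move=> x y z; rewrite /br /=; congr pair => /=.
    rewrite !(bilDr lb) !mu_equiv !(bilBr mu_bil).
    rewrite !(muC x.2 (rho _ _)) !(muC y.2 (rho _ _)) !(muC z.2 (rho _ _)).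
    rewrite -(lie_jacobi x.1 y.1 z.1).
    by apply: linear_functionals_inj => f fD fZ fN; rewrite !(fD, fN); ring.
  rewrite !rhoD !rhoL !add_lfunE !opp_lfunE !comp_lfunE !lfunD !lfunN.
  rewrite -[RHS]oppr0 -(bianchi x.2 y.2 z.2).
  by apply: linear_functionals_inj => f fD fZ fN; rewrite !(fD, fN); ring.
split.
- split=> [y a u v|u a x y]; rewrite /br /=; congr pair => /=.
  + by rewrite (bilDl lb) (bilZl lb) (bilDl mu_bil) (bilZl mu_bil) scalerDr addrACA.
  + rewrite rhoD rhoZ lfunD lfunZ.
    by apply: linear_functionals_inj => f fD fZ fN; rewrite !(fD, fN, fZ); ring.
  + by rewrite (bilDr lb) (bilZr lb) (bilDr mu_bil) (bilZr mu_bil) scalerDr addrACA.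
  + rewrite rhoD rhoZ lfunD lfunZ.
    by apply: linear_functionals_inj => f fD fZ fN; rewrite !(fD, fN, fZ); ring.
- move=> x y; rewrite /br; congr pair => /=; last by rewrite opprB.
  by rewrite lieC muC -opprD.
split=> [a b|a v|v w|a v w]; rewrite /br /=.
- by rewrite (bil0l mu_bil) addr0 !lfun0 subrr.
- by rewrite (bil0r lb) (bil0l mu_bil) addr0 lfun0 subr0.
- by rewrite !rho0 subrr.
- by rewrite (bil0l lb) add0r muE.
Qed.

End Bracket.

(** * The Bianchi forms of h and sp(1) *)

Lemma ord3_ind (P : 'I_3 -> Prop) : P 0 -> P 1 -> P 2 -> forall i, P i.
Proof.
move=> P0 P1 P2; case=> [[|[|[|//]]] lt3].
- by have -> : Ordinal lt3 = 0 by exact: val_inj.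
- by have -> : Ordinal lt3 = 1 by exact: val_inj.
- by have -> : Ordinal lt3 = 2 by exact: val_inj.
Qed.

Lemma sum_ord3 (V : nmodType) (G : 'I_3 -> V) : \sum_p G p = G 0 + G 1 + G 2.
Proof.
rewrite 3!big_ord_recl big_ord0 addr0 !addrA.
by congr (_ + G _ + G _); apply: val_inj.
Qed.

Lemma sp1_formE (R : realType) (u v : sp1 R) :
  sp1_form u v = u 0 0 * v 0 0 + u 0 1 * v 0 1 + u 0 2 * v 0 2.
Proof. by rewrite /sp1_form sum_ord3. Qed.

Lemma sum_form_euclidean (R : realType) (h : lieAlgType R) (Bh : h -> h -> R^o)
    r :
  euclidean_product Bh -> 0 < r -> euclidean_product (sum_form Bh r (@sp1_form R)).
Proof.
move=> euBh r_gt0; split=> [|x y|[x u] xu0].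
- split=> [v a x y|u a x y]; rewrite /sum_form /= !sp1_formE !mxE.
    rewrite (euclidDl euBh) (euclidZl euBh) -[_ *: _]/(_ * _); ring.
  rewrite (euclidDr euBh) (euclidZr euBh) -[_ *: _]/(_ * _); ring.
- by rewrite /sum_form !sp1_formE (euclidC euBh); congr (_ + _); ring.
rewrite /sum_form /= sp1_formE -!expr2.
have [x0|/(euclid_gt0 euBh) x0] := eqVneq x 0; last first.
  have s_ge0 : 0 <= u 0 0 ^+ 2 + u 0 1 ^+ 2 + u 0 2 ^+ 2.
    by rewrite !addr_ge0 ?sqr_ge0.
  exact: ltr_pwDl x0 (mulr_ge0 (ltW r_gt0) s_ge0).
rewrite x0 (bil0l (euclid_bil euBh)) add0r pmulr_rgt0 // lt_neqAle.
rewrite !addr_ge0 ?sqr_ge0 // andbT eq_sym; apply: contra xu0.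
rewrite !paddr_eq0 ?addr_ge0 ?sqr_ge0 // !sqrf_eq0 -andbA x0.
by case/and3P=> /eqP u0 /eqP u1 /eqP u2; rewrite (_ : u = 0) //; apply: sp1P;
  rewrite ?u0 ?u1 ?u2 mxE.
Qed.

Lemma sum_form_ad_invariant (R : realType) (h : lieAlgType R) (Bh : h -> h -> R^o)
    r :
  ad_invariant Bh -> ad_invariant (sum_form Bh r (@sp1_form R)).
Proof.
move=> adBh x y z; rewrite /sum_form /= adBh; congr (_ + _ * _).
rewrite (_ : lie x.2 y.2 = sp1_lie x.2 y.2) //.
rewrite (_ : lie y.2 z.2 = sp1_lie y.2 z.2) // !sp1_formE !sp1_lieE !mxE /=; ring.
Qed.

Lemma dim1_colinear (R : realType) (V : vectType R) (U : {vspace V}) s t :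
  \dim U = 1%N -> s \in U -> s != 0 -> t \in U -> exists c, t = c *: s.
Proof.
move=> dU sU s0 tU; apply/vlineP.
by have /eqP -> : (<[s]> == U)%VS by rewrite eqEdim -memvE sU dU dim_vline s0.
Qed.

(** * Orthogonality for the Hilbert-Schmidt product *)

Section HilbertSchmidt.
Variables (R : realType) (V : vectType R) (Bm : V -> V -> R^o).
Hypothesis euBm : euclidean_product Bm.
Variables (n : nat) (o : 'I_n -> V).
Hypothesis oP : orthonormal_basis Bm o.

(** The matrix of [Q] in the basis [o] is skew, and exchanging the summations transposes it. [S] and
    [T] are plain functions so that composites can be inserted. *)
Lemma hs_skew (S T Q : V -> V) : linear S -> linear T ->
  (forall v w, Bm (Q v) w = - (Bm v (Q w) : R)) ->
  \sum_a (Bm (S (o a)) (T (Q (o a))) : R) =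
  - \sum_a (Bm (S (Q (o a))) (T (o a)) : R).
Proof.
move=> Sl Tl Q_skew.
have E1 a : (Bm (S (o a)) (T (Q (o a))) : R) =
    \sum_b (Bm (o b) (Q (o a)) : R) * Bm (S (o a)) (T (o b)).
  rewrite {1}(oP.2 (Q (o a))) (linear_sum_scale _ _ _ _ Tl) (euclid_sumr euBm).
  by apply: eq_bigr => b _; rewrite (euclidZr euBm).
have E2 a : (Bm (S (Q (o a))) (T (o a)) : R) =
    \sum_b (Bm (o b) (Q (o a)) : R) * Bm (S (o b)) (T (o a)).
  rewrite {1}(oP.2 (Q (o a))) (linear_sum_scale _ _ _ _ Sl) (euclid_suml euBm).
  by apply: eq_bigr => b _; rewrite (euclidZl euBm).
rewrite (eq_bigr _ (fun a _ => E1 a)) (eq_bigr _ (fun a _ => E2 a)).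
rewrite [in RHS]exchange_big -sumrN; apply: eq_bigr => a _; rewrite -sumrN.
apply: eq_bigr => b _; rewrite -mulNr; congr (_ * _).
by rewrite -Q_skew (euclidC euBm).
Qed.

(* With <X, T> for the sum: <X, T> = <Q X, Q T> = - <X Q, T Q> = <X Q Q, T>. *)
Lemma hs_orthogonal (X T Q : 'End(V)) :
  (forall v w, Bm (Q v) w = - (Bm v (Q w) : R)) -> (forall v, Q (Q v) = - v) ->
  (forall v, X (Q v) = Q (X v)) -> (forall v, T (Q v) = - Q (T v)) ->
  \sum_a (Bm (X (o a)) (T (o a)) : R) = 0.
Proof.
move=> Q_skew QQ XQ TQ; set s := LHS.
have s1 : s = \sum_a (Bm (Q (X (o a))) (Q (T (o a))) : R).
  by apply: eq_bigr => a _; rewrite Q_skew QQ (euclidNr euBm) opprK.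
have s2 : s = - \sum_a (Bm (X (Q (o a))) (T (Q (o a))) : R).
  rewrite s1 -sumrN; apply: eq_bigr => a _.
  by rewrite XQ TQ (euclidNr euBm) opprK.
have XQl : linear (fun x => X (Q x)) by move=> a x y; rewrite !linearP.
have Tl : linear T by move=> a x y; rewrite linearP.
have /= s3 := hs_skew XQl Tl Q_skew.
have s4 : s = - s; last by lra.
rewrite {1}s2 s3 opprK -sumrN; apply: eq_bigr => a _.
by rewrite QQ lfunN (euclidNl euBm).
Qed.

End HilbertSchmidt.

(** * Contractions and proportionality of the two 4-forms *)

Section MainIdentity.
Variables (R : realType) (h : lieAlgType R) (Bh : h -> h -> R^o).
Variables (m : vectType R) (rho : h -> 'End(m)) (I J K : 'End(m)).
Variable Bm : m -> m -> R^o.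
Hypotheses (euBh : euclidean_product Bh) (adBh : ad_invariant Bh).
Hypothesis irr : irreducible_rep rho.
Hypothesis quatIJK : quaternionic_structure rho I J K.
Hypotheses (euBm : euclidean_product Bm).
Hypothesis invBm : rep_invariant (rep_plus_sp1 rho I J K) Bm.
Variables (N : nat) (eps : 'I_N -> h).
Hypothesis epsP : orthonormal_basis Bh eps.

Local Notation rho' := (rep_plus_sp1 rho I J K).
Let A i := rho (eps i).
Definition sp1_end (i : 'I_3) : 'End(m) := [:: I; J; K]`_i.
Local Notation Q := sp1_end.

Lemma rep_skew x v w : Bm (rho' x v) w = - Bm v (rho' x w).
Proof. by apply/eqP; rewrite -addr_eq0; apply/eqP/invBm. Qed.

Lemma rho_skew x v w : Bm (rho x v) w = - Bm v (rho x w).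
Proof. by rewrite -(rep_plus_sp1_l rho I J K x) rep_skew. Qed.

Lemma rep_delta i v : rho' (0, delta_mx 0 i) v = Q i v.
Proof.
rewrite rep_plus_sp1_r //; elim/ord3_ind: i; rewrite !mxE /= ?scale1r ?scale0r;
  by rewrite ?addr0 ?add0r.
Qed.

Lemma sp1_end_skew i v w : Bm (Q i v) w = - Bm v (Q i w).
Proof. by rewrite -!rep_delta rep_skew. Qed.

Lemma rho_sp1_end x i v : Q i (rho x v) = rho x (Q i v).
Proof.
have [[cI cJ cK] _] := quatIJK.
have cE T : commutes_with rho T -> T (rho x v) = rho x (T v).
  by move=> /(_ x)/lfunP/(_ v); rewrite !comp_lfunE.
by elim/ord3_ind: i; apply: cE.
Qed.

Lemma rep_expand x v : rho' x v = rho x.1 v + \sum_i x.2 0 i *: Q i v.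
Proof. by rewrite rep_plus_sp1E sum_ord3 !addrA. Qed.

Lemma rho_sum x v : rho x v = \sum_i (Bh (eps i) x : R) *: A i v.
Proof.
have [[lrho _] _ _] := irr.
rewrite {1}(epsP.2 x) (linear_sum_scale _ _ _ _ lrho) sum_lfunE.
by apply: eq_bigr => i _; rewrite scale_lfunE.
Qed.

(** The bracket of two elements of m; [r^-1] compensates for the weight [r] of sp(1) in
    [sum_form]. *)
Definition moment_map r v w : (h * sp1 R)%type :=
  (\sum_i (Bm (A i v) w : R) *: eps i, r^-1 *: \row_i (Bm (Q i v) w : R)).

Lemma moment_mapE r a v w : r != 0 ->
  sum_form Bh r (@sp1_form R) a (moment_map r v w) = Bm (rho' a v) w.
Proof.
move=> r0; rewrite /sum_form rep_expand (euclidDl euBm); congr (_ + _).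
  rewrite rho_sum (euclid_suml euBm) (euclid_sumr euBh); apply: eq_bigr => i _.
  by rewrite (euclidZl euBm) (euclidZr euBh) (euclidC euBh) mulrC.
rewrite (euclid_suml euBm) mulr_sumr; apply: eq_bigr => i _.
by rewrite (euclidZl euBm) !mxE; field.
Qed.

Lemma moment_map_square r v w u z :
  Bm (rho' (moment_map r v w) u) z =
  square_form Bm A v w u z + r^-1 * square_form Bm Q v w u z :> R.
Proof.
have [[lrho _] _ _] := irr.
rewrite rep_expand (euclidDl euBm) /=; congr (_ + _).
  rewrite (linear_sum_scale _ _ _ _ lrho) sum_lfunE (euclid_suml euBm).
  by apply: eq_bigr => i _; rewrite scale_lfunE (euclidZl euBm).
rewrite (euclid_suml euBm) mulr_sumr; apply: eq_bigr => i _.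
by rewrite (euclidZl euBm) !mxE mulrA.
Qed.

Lemma moment_map_bianchi r v w u z :
  Bm (rho' (moment_map r v w) u + rho' (moment_map r w u) v +
      rho' (moment_map r u v) w) z =
  bianchi_form Bm A v w u z + r^-1 * bianchi_form Bm Q v w u z :> R.
Proof. by rewrite !(euclidDl euBm) !moment_map_square /bianchi_form; ring. Qed.

Definition casimir w := \sum_i A i (A i w).

Variables (n : nat) (o : 'I_n -> m).
Hypothesis oP : orthonormal_basis Bm o.

Lemma I_sp1_end : I = Q 0. Proof. by []. Qed.

(** The trace terms vanish by [hs_orthogonal], since J commutes with h and anticommutes with I. In
    the other terms I passes through [A i], leaving the Casimir operator. *)
Lemma contraction_rho v w :
  \sum_a bianchi_form Bm A v w (o a) (I (o a)) = - 2 * Bm v (I (casimir w)).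
Proof.
have A_skew i := rho_skew (eps i).
have rel := quaternionic_relations quatIJK.
rewrite (bianchi_contraction euBm A_skew _ _ oP (sp1_end_skew 0)).
rewrite /casimir [I _]linear_sum (euclid_sumr euBm) mulr_sumr; apply: eq_bigr => i _.
rewrite (hs_orthogonal euBm oP (Q := J)) ?mulr0 ?add0r.
- by rewrite A_skew -(rho_sp1_end _ 0) /=; ring.
- exact: (sp1_end_skew 1).
- by move=> x; case: (rel x) => -[].
- by move=> x; rewrite -(rho_sp1_end _ 1).
- by move=> x; case: (rel x) => -[_ _ _] [-> _ _ [-> _ _]]; rewrite opprK.
Qed.

(** I, J, K are pairwise orthogonal, so only I has a nonzero trace against I, giving the [n]; the 2
    comes from I I I + J I J + K I K = I. *)
Lemma contraction_sp1 v w :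
  \sum_a bianchi_form Bm Q v w (o a) (I (o a)) = - (n%:R + 2) * Bm v (I w).
Proof.
have rel := quaternionic_relations quatIJK.
rewrite (bianchi_contraction euBm sp1_end_skew _ _ oP (sp1_end_skew 0)).
rewrite sum_ord3 /=.
have -> : \sum_a (Bm (Q 0 (o a)) (Q 0 (o a)) : R) = n%:R.
  rewrite -[n in RHS]card_ord -sumr_const; apply: eq_bigr => a _.
  rewrite sp1_end_skew; have [[-> _ _] _] := rel (o a).
  by rewrite (euclidNr euBm) opprK oP.1 eqxx.
have -> : \sum_a (Bm (Q 1 (o a)) (Q 0 (o a)) : R) = 0.
  apply: (hs_orthogonal euBm oP (Q := J)) => //.
  - exact: (sp1_end_skew 1).
  - by move=> x; case: (rel x) => -[].
  - by move=> x; case: (rel x) => -[_ _ _] [-> _ _ [-> _ _]]; rewrite opprK.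
have -> : \sum_a (Bm (Q 2 (o a)) (Q 0 (o a)) : R) = 0.
  apply: (hs_orthogonal euBm oP (Q := K)) => //.
  - exact: (sp1_end_skew 2).
  - by move=> x; case: (rel x) => -[].
  - by move=> x; case: (rel x) => -[_ _ _] [_ _ -> [_ _ ->]].
rewrite !sp1_end_skew -!I_sp1_end.
have e0 : I (I (I w)) = - I w by have [[-> _ _] _] := rel (I w).
have e1 : Q 1 (I (Q 1 w)) = I w.
  by have [_ [-> _ _ _]] := rel w; have [_ [_ -> _ _]] := rel w.
have e2 : Q 2 (I (Q 2 w)) = I w.
  have [_ [_ _ _ [_ _ ->]]] := rel w; have [_ [_ _ _ [_ kj _]]] := rel w.
  by rewrite lfunN kj opprK.
by rewrite e0 e1 e2 (euclidNr euBm); ring.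
Qed.

Lemma bianchi_map_rep_invariant : [/\
  forall x v, \sum_p bianchi_map Bm A (upd v p (rho' x (v p))) = 0 &
  forall x v, \sum_p bianchi_map Bm Q (upd v p (rho' x (v p))) = 0].
Proof.
have [[lrho rhoL] _ _] := irr; split=> x.
  (* The sp(1) part of [x] commutes with h, so only [x.1] contributes, through its adjoint
     matrix. *)
  apply: (bianchi_map_invariant euBm (c := fun i j => Bh (eps j) (lie (eps i) x.1))).
  - exact: rep_skew.
  - by move=> i j; rewrite -!adBh lieC (euclidNl euBh).
  - move=> i v; rewrite -rho_sum rhoL add_lfunE opp_lfunE !comp_lfunE !rep_expand.
    rewrite lfunD linear_sum opprD addrACA -[RHS]addr0; congr (_ + _).
    apply/eqP; rewrite subr_eq0; apply/eqP.
    by apply: eq_bigr => j _; rewrite linearZ /= -rho_sp1_end.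
pose a := x.2 0 0; pose b := x.2 0 1; pose d := x.2 0 2.
(* Row [i] holds the coefficients on I, J, K of the commutator of [Q i] with a I + b J + d K. *)
pose c (i j : 'I_3) : R := nth 0 (nth [::] [:: [:: 0; - 2 * d; 2 * b];
  [:: 2 * d; 0; - 2 * a]; [:: - 2 * b; 2 * a; 0]] i) j.
apply: (bianchi_map_invariant euBm (c := c)).
- exact: rep_skew.
- by move=> i j; rewrite /c; elim/ord3_ind: i; elim/ord3_ind: j => /=; ring.
move=> i v; rewrite !rep_expand !sum_ord3 -/a -/b -/d lfunD rho_sp1_end.
have [[ii jj kk] [ij jk ki [ji kj ik]]] := quaternionic_relations quatIJK v.
rewrite -[Q 0]/I -[Q 1]/J -[Q 2]/K /c !(lfunD, lfunZ).
elim/ord3_ind: i => /=; rewrite -?[Q 0]/I -?[Q 1]/J -?[Q 2]/K.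
- rewrite ii ij ik ji ki; apply: linear_functionals_inj => f fD fZ fN.
  by rewrite !(fD, fN, fZ); ring.
- rewrite jj ij jk ji kj; apply: linear_functionals_inj => f fD fZ fN.
  by rewrite !(fD, fN, fZ); ring.
- rewrite kk ik jk ki kj; apply: linear_functionals_inj => f fD fZ fN.
  by rewrite !(fD, fN, fZ); ring.
Qed.

(** Both forms give tensors in a space of dimension 1, and the one of sp(1) is nonzero because its
    contraction is. *)
Lemma bianchi_form_proportional :
  \dim (ext_invariants 4 rho') = 1%N ->
  exists c, forall v w u z,
    bianchi_form Bm A v w u z = c * bianchi_form Bm Q v w u z.
Proof.
move=> dim1; have [d dE] := exists_dual_vectors euBm.
have [[lrho' _] _ _] := rep_plus_sp1_irreducible quatIJK irr.
have [invA invQ] := bianchi_map_rep_invariant.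
have A_skew i := rho_skew (eps i).
have mA := bianchi_map_multilinear euBm A_skew.
have mQ := bianchi_map_multilinear euBm sp1_end_skew.
have aA := bianchi_map_alternating euBm A_skew.
have aQ := bianchi_map_alternating euBm sp1_end_skew.
have tA : form_tensor d (bianchi_map Bm A) \in ext_invariants 4 rho'.
  apply/(ext_invariantsP _ lrho'); split=> [|x]; first exact: form_tensor_ext_pow.
  by apply: (form_tensor_act euBm dE) => //; apply: invBm.
have tQ : form_tensor d (bianchi_map Bm Q) \in ext_invariants 4 rho'.
  apply/(ext_invariantsP _ lrho'); split=> [|x]; first exact: form_tensor_ext_pow.
  by apply: (form_tensor_act euBm dE) => //; apply: invBm.
have mapE N' (A' : 'I_N' -> 'End(m)) v w u z : bianchi_form Bm A' v w u z =
    bianchi_map Bm A' [ffun i : 'I_4 => [:: v; w; u; z]`_i].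
  by rewrite /bianchi_map !ffunE.
have tQ0 : form_tensor d (bianchi_map Bm Q) != 0.
  apply/eqP => tQ0; have [_ m0 _] := irr; pose v := vpick {:m}.
  have v0 : v != 0 by rewrite vpick0.
  have := contraction_sp1 (I v) v; rewrite big1 => [|a _]; last first.
    rewrite mapE (form_tensor_inj euBm dE (G := bianchi_map Bm Q) (c := 0)) ?mul0r //.
    by rewrite tQ0 scaler0.
  rewrite (sp1_end_skew 0 v) -I_sp1_end.
  have [[-> _ _] _] := quaternionic_relations quatIJK v.
  rewrite (euclidNr euBm) opprK; have := euclid_gt0 euBm v0.
  have : 0 <= n%:R :> R by []. nra.
have [c tc] := dim1_colinear dim1 tQ tQ0 tA.
by exists c => v w u z; rewrite !mapE; apply: (form_tensor_inj euBm dE).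
Qed.

End MainIdentity.

(** * The Casimir operator determines the weight *)

Section Uniqueness.
Variables (R : realType) (h : lieAlgType R) (Bh : h -> h -> R^o).
Variables (m : vectType R) (rho : h -> 'End(m)) (I J K : 'End(m)).
Hypothesis euBh : euclidean_product Bh.
Hypotheses (irr : irreducible_rep rho).
Hypothesis quatIJK : quaternionic_structure rho I J K.
Variables (N : nat) (eps : 'I_N -> h).
Hypothesis epsP : orthonormal_basis Bh eps.
Local Notation rho' := (rep_plus_sp1 rho I J K).
Local Notation form r := (sum_form Bh r (@sp1_form R)).

(** Contracting the Jacobi identity with I. The product [Bm] supplied by [s_representation] depends
    on the hypothesis, so the conclusion avoids it and can be compared for two values of [r]. *)
Lemma s_representation_casimir r w : 0 < r -> s_representation (form r) rho' ->
  2 *: I (casimir rho eps w) = - ((\dim {:m})%:R + 2) / r *: I w.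
Proof.
move=> r_gt0 [euB _ [rep' _ _] [Bm [euBm inv [br [brP jac]]]]].
have muE a v u := moment_mapE I J K euBh irr euBm epsP a v u (lt0r_neq0 r_gt0).
have bian := s_bracket_bianchi euB muE rep' brP jac.
have [o oP] := exists_orthonormal_basis euBm.
apply: (euclid_inj euBm) => v.
have cA := contraction_rho irr quatIJK euBm inv eps oP v w.
have cQ := contraction_sp1 irr quatIJK euBm inv oP v w.
rewrite !(euclidZr euBm).
have : \sum_a (bianchi_form Bm (fun i => rho (eps i)) v w (o a) (I (o a)) +
    r^-1 * bianchi_form Bm (sp1_end I J K) v w (o a) (I (o a))) = 0.
  rewrite big1 // => a _; rewrite -(moment_map_bianchi I J K irr euBm) bian.
  exact: bil0l (euclid_bil euBm) _.
rewrite big_split /= -mulr_sumr cA cQ.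
set x := (Bm v (I (casimir _ _ _)) : R); set y := (Bm v (I w) : R); lra.
Qed.

End Uniqueness.

Theorem proposition2p9 (R : realType) (h : lieAlgType R) (Bh : h -> h -> R^o)
    (m : vectType R) (rho : h -> 'End(m)) (I J K : 'End(m)) :
  euclidean_product Bh -> ad_invariant Bh ->
  irreducible_rep rho -> faithful_rep rho -> quaternionic_type rho ->
  quaternionic_structure rho I J K ->
  \dim (ext_invariants 4 (rep_plus_sp1 rho I J K)) = 1%N ->
  exists! r : R, 0 < r /\
    s_representation (sum_form Bh r (@sp1_form R)) (rep_plus_sp1 rho I J K).
Proof.
move=> euBh adBh irr _ qrho quatIJK dim1; set rho' := rep_plus_sp1 rho I J K.
have irr' := rep_plus_sp1_irreducible quatIJK irr.
have [[lrho' _] m0 _] := irr'; have [_ _ mU] := irr.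
pose u := vpick {:m}; have u0 : u != 0 by rewrite vpick0.
have rel := quaternionic_relations quatIJK.
have [eps epsP] := exists_orthonormal_basis euBh.
pose t := vpick (ext_invariants 4 rho').
have t0 : t != 0 by rewrite vpick0 -dimv_eq0 dim1.
have [_ t_inv] := ext_invariantsP _ lrho' (memv_pick (ext_invariants 4 rho')).
(* The weight 1 is an arbitrary choice of invariant product on h + sp(1). *)
have [Bm euBm inv] := exists_invariant_product (sum_form_euclidean euBh ltr01)
  (sum_form_ad_invariant 1 adBh) irr' (rep_plus_sp1_schur quatIJK irr qrho)
  (isT : (0 < 4)%N) t0 t_inv.
have [o oP] := exists_orthonormal_basis euBm.
have [c cE] := bianchi_form_proportional euBh adBh irr quatIJK euBm inv epsP oP dim1.
have n2_gt0 : 0 < (\dim {:m})%:R + 2 :> R by rewrite ltr_wpDl.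
(* Contracting at the arguments [I v] and [v] turns both sides into squared norms, as I is an
   isometry. *)
have norm_c v : 2 * \sum_i (Bm (rho (eps i) v) (rho (eps i) v) : R) =
    - c * ((\dim {:m})%:R + 2) * Bm v v.
  have cA := contraction_rho irr quatIJK euBm inv eps oP (I v) v.
  have cQ := contraction_sp1 irr quatIJK euBm inv oP (I v) v.
  have : \sum_a bianchi_form Bm (fun i => rho (eps i)) (I v) v (o a) (I (o a)) =
      c * \sum_a bianchi_form Bm (sp1_end I J K) (I v) v (o a) (I (o a)).
    by rewrite mulr_sumr; apply: eq_bigr => a _; rewrite cE.
  have II w : (Bm (I v) (I w) : R) = Bm v w.
    rewrite (sp1_end_skew irr inv 0 v) /=; have [[-> _ _] _] := rel w.
    by rewrite (euclidNr euBm) opprK.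
  rewrite cA cQ !II /casimir (euclid_sumr euBm).
  have -> : \sum_i (Bm v (rho (eps i) (rho (eps i) v)) : R) =
      - \sum_i (Bm (rho (eps i) v) (rho (eps i) v) : R).
    by rewrite -sumrN; apply: eq_bigr => i _; rewrite (rho_skew inv (eps i) v) opprK.
  set x := \sum_i _; set y := (Bm v v : R); set k := (_ + 2 : R) => E.
  have -> : - c * k * y = c * (- k * y) by ring.
  by rewrite -E mulrNN.
have c_lt0 : c < 0.
  rewrite lt_neqAle; apply/andP; split; last first.
    have u_gt0 := euclid_gt0 euBm u0.
    have : 0 <= 2 * \sum_i (Bm (rho (eps i) u) (rho (eps i) u) : R).
      by rewrite mulr_ge0 // sumr_ge0 // => i _; exact: euclid_ge0.
    by rewrite norm_c pmulr_lge0 // pmulr_lge0 // oppr_ge0.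
  (* If [c = 0] then h acts by zero, every line is stable, and irreducibility puts [I u] on the line
     of [u], against [quaternionic_free]. *)
  apply/eqP => c0.
  have rho0 x v : rho x v = 0.
    rewrite (rho_sum irr epsP) big1 // => i _.
    suff -> : rho (eps i) v = 0 by rewrite scaler0.
    apply: (euclid_eq0 euBm).
    have := norm_c v; rewrite c0 oppr0 !mul0r => /eqP.
    rewrite mulf_eq0 pnatr_eq0 /= psumr_eq0 => [/allP/(_ i (mem_index_enum _))|j _].
      by move/eqP.
    exact: euclid_ge0.
  have /vlineP[a Iu] : I u \in <[u]>%VS.
    have [x|/eqP|->] := mU <[u]>%VS; last exact: memvf.
      by apply/subvP => _ /memv_imgP[v _ ->]; rewrite rho0 mem0v.
    by rewrite -dimv_eq0 dim_vline u0.
  have [] := @quaternionic_free _ _ _ _ _ _ _ quatIJK u a (-1) 0 0 u0.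
    by rewrite Iu !scale0r !addr0 scaleN1r subrr.
  by move=> _ /eqP; rewrite oppr_eq0 oner_eq0.
have r_gt0 : 0 < - c^-1 by rewrite oppr_gt0 invr_lt0.
(* With [r = - c^-1] the factor [r^-1] is [- c], which cancels the proportionality constant of the
   two forms. *)
have rrep : s_representation (sum_form Bh (- c^-1) (@sp1_form R)) rho'.
  have muE a v w := moment_mapE I J K euBh irr euBm epsP a v w (lt0r_neq0 r_gt0).
  have euB := sum_form_euclidean euBh r_gt0.
  apply: (s_representation_of_bianchi euB euBm muE) => //.
    exact: sum_form_ad_invariant.
  move=> v w z; apply: (euclid_inj euBm) => y; rewrite (euclidC euBm).
  rewrite (moment_map_bianchi I J K irr euBm) cE invrN invrK mulNr subrr.
  by rewrite (bil0r (euclid_bil euBm)).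
exists (- c^-1); split=> // s [s_gt0 srep].
(* The left side of the Casimir identity at [u] does not involve the weight, so the two right sides
   agree; [I u] is nonzero and can be cancelled. *)
have := s_representation_casimir euBh irr quatIJK epsP u s_gt0 srep.
rewrite (s_representation_casimir euBh irr quatIJK epsP u r_gt0 rrep) => /eqP.
have Iu0 : I u != 0.
  apply: contra u0 => /eqP Iu; have [[IIu _ _] _] := rel u.
  by rewrite -oppr_eq0 -IIu Iu lfun0.
rewrite -subr_eq0 -scalerBl scaler_eq0 (negPf Iu0) orbF subr_eq0.
have k0 : - ((\dim {:m})%:R + 2) != 0 :> R by rewrite oppr_eq0 gt_eqF.
by rewrite (inj_eq (mulfI k0)) => /eqP /invr_inj.
Qed.
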